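(* Let $q\ge5$ be a prime power with $q\equiv\xi\pmod 3$, $\xi\in\{-1,0,1\}$, and let $\mathcal{C}_\mathscr{C}$ be the $[q+1,q-3,5]_q$ code with parity check matrix whose columns are the vectors $(1,t,t^2,t^3)$, $t\in\mathbb{F}_q$, and $(0,0,0,1)$. Then: (i) All weight-$1$ cosets of $\mathcal{C}_\mathscr{C}$ have the same weight distribution. (ii) If $\xi\ne1$, all weight-$2$ cosets have the same weight distribution. If $\xi=1$, there are exactly $2$ distinct weight distributions of weight-$2$ cosets, the numbers of corresponding cosets being $\frac13(q^3-q)(q-1)$ and $\frac16(q^3-q)(q-1)$. (iii) If $\xi=1$, there are exactly $2$ distinct weight distributions of weight-$3$ cosets, the numbers of corresponding cosets being $(q^2+q)(q-1)$ and $\frac12(q^3-q)(q-1)$. If $\xi=-1$, there are exactly $3$ distinct weight distributions of weight-$3$ cosets, the numbers of corresponding cosets being $(q^2+q)(q-1)$, $\frac13(q^3-q)(q-1)$ and $\frac16(q^3-q)(q-1)$. If $\xi=0$, there are exactly $2$ distinct weight distributions of weight-$3$ cosets, the numbers of corresponding cosets being $(q^2-1)(q-1)$ and $\frac12(q+1)(q^2-q+2)(q-1)$.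
   Context: A coset of a linear code $\mathcal{C}\subseteq\mathbb{F}_q^n$ is a set $\mathbf{v}+\mathcal{C}$; its weight is the minimum Hamming weight of its vectors; its weight distribution is the sequence $(B_w)_w$ where $B_w$ is the number of its vectors of Hamming weight $w$. *)

(* Defs.v *)
From mathcomp Require Import all_boot all_order all_algebra.
Set Implicit Arguments. Unset Strict Implicit. Unset Printing Implicit Defensive.
Import GRing.Theory.
Local Open Scope ring_scope.

(* Coordinates of F_q^{q+1} are indexed by [option F]:
   [Some t] <-> column (1,t,t^2,t^3), [None] <-> column (0,0,0,1). *)
Section Code.
Variable F : finFieldType.

Definition vec := {ffun option F -> F}.

Definition pcol (i : option F) (k : 'I_4) : F :=
  match i with
  | Some t => t ^+ k
  | None => if k == 3 :> nat then 1 else 0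
  end.

Definition syndrome (u : vec) (k : 'I_4) : F := \sum_i u i * pcol i k.

Definition code : {set vec} := [set c : vec | [forall k, syndrome c k == 0]].

Definition vadd (u v : vec) : vec := [ffun i => u i + v i].

Definition wt (u : vec) : nat := #|[set i | u i != 0]|.

Definition coset (v : vec) : {set vec} := [set vadd v c | c in code].

Definition cosets : {set {set vec}} := [set coset v | v : vec].

(* weight of a coset: minimal Hamming weight of its vectors
   (the default #|{: option F}| = q+1 is an upper bound on every weight) *)
Definition coset_wt (X : {set vec}) : nat := \big[minn/#|{: option F}|]_(u in X) wt u.

Definition wdist (X : {set vec}) : seq nat :=
  [seq #|[set u in X | wt u == w]| | w <- iota 0 (#|{: option F}|).+1].

Definition ncos (j : nat) (d : seq nat) : nat :=
  #|[set X in cosets | (coset_wt X == j) && (wdist X == d)]|.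
End Code.

(* Main.v *)
Require Import Defs.
From mathcomp Require Import all_boot all_order all_algebra.
From mathcomp Require Import finfield ring zify.
Set Implicit Arguments. Unset Strict Implicit. Unset Printing Implicit Defensive.
Import GRing.Theory.

(** Cosets correspond to syndromes [s] in F^4, that is, to linear functionals
    on binary cubic forms; let T_s be the polar trilinear form of [s] on P^1(F).
    Any four columns of the parity check matrix are independent, so for every
    set S of at least four coordinates the number of vectors supported in S
    with syndrome [s] does not depend on [s].  By double counting, the weight
    distribution of a coset is therefore determined by the numbers A_m(s),
    m <= 3, of pairs (S, u) with #|S| = m, [supp u] in S and syndrome [s].
    The numbers A_0, A_1, A_2 depend only on the weight of the coset, while
    A_3 counts the triples {x, y, z} with T_s(x, y, z) = 0.  For x <> y this
    equation has exactly one solution z unless T_s(x, y, -) vanishes, which gives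
        6 A_3 + 2 (q + 1) + 2 q t = q (q + 1) + 2 q A_2 + 2 r,
    where r = #{z | T_s(z, z, z) = 0} (osculating planes through [s]) and
    t = #{x | T_s(x, x, -) = 0} (tangents through [s]).

    Hence everything reduces to the joint distribution of the coset weight, r
    and t.  On a secant T_s(z, z, z) is a combination of two cubes, so r is 1
    if cubing is injective and 0 or 3 otherwise.  If 3 <> 0 in F, the moments of
    r over all [s] give the number of [s] with each value of r; comparing these
    with the number of points on secants and on tangents forces the distribution
    on the cosets of weight 3.  If 3 = 0, then T_s(z, z, z) is itself a difference
    of two cubes and r is read off directly. *)

(** * The twisted cubic and its polar form *)

Section TwistedCubic.
Local Open Scope ring_scope.
Variable F : finFieldType.
Local Notation q := #|F|.
Local Notation pt := (option F).
Local Notation vec := (vec F).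
Implicit Types (x y z w i j : pt) (u v : vec) (S A : {set pt}).

(* Homogeneous coordinates on P^1: [Some t] is (1 : t) and [None] is (0 : 1). *)
Definition pa x : F := if x is Some _ then 1 else 0.
Definition pb x : F := if x is Some t then t else 1.
Definition br x y : F := pa x * pb y - pb x * pa y.

(** In homogeneous coordinates the column at infinity needs no separate treatment: at [None] the
    factor [0 ^+ (3 - k)] is 1 exactly when [k = 3]. *)
Lemma pcolE x (k : 'I_4) : pcol x k = pa x ^+ (3 - k) * pb x ^+ k.
Proof.
case: x => [t|] /=; first by rewrite expr1n mul1r.
case: k => [[|[|[|[|k]]]] Hk] //=; by rewrite ?expr0n /= ?expr1n ?mul0r ?mul1r.
Qed.

Lemma br_eq0 x y : (br x y == 0) = (x == y).
Proof.
case: x y => [a|] [b|]; rewrite /br /= ?mul1r ?mulr1 ?mul0r ?mulr0 ?subr0 ?sub0r.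
- by rewrite subr_eq0 eq_sym.
- by rewrite oner_eq0.
- by rewrite oppr_eq0 oner_eq0.
- by rewrite !eqxx.
Qed.

Lemma brxx x : br x x = 0. Proof. by apply/eqP; rewrite br_eq0. Qed.

Lemma br_neq0 x y : x != y -> br x y != 0. Proof. by rewrite br_eq0. Qed.

Definition quad : finType := (F * F * F * F)%type.
Implicit Type s : quad.

(* [pol s x y z] is the value of the functional [s] on the cubic form whose
   zeros are x, y and z. *)
Definition polU s x y : F := let: (s0, s1, s2, s3) := s in
  pa x * pa y * s3 - (pa x * pb y + pb x * pa y) * s2 + pb x * pb y * s1.
Definition polV s x y : F := let: (s0, s1, s2, s3) := s in
  pa x * pa y * s2 - (pa x * pb y + pb x * pa y) * s1 + pb x * pb y * s0.
Definition pol s x y z : F := pa z * polU s x y - pb z * polV s x y.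

Lemma polC s x y z : pol s x y z = pol s y x z.
Proof. by case: s => [[[s0 s1] s2] s3]; rewrite /pol /polU /polV; ring. Qed.
Lemma polAC s x y z : pol s x y z = pol s x z y.
Proof. by case: s => [[[s0 s1] s2] s3]; rewrite /pol /polU /polV; ring. Qed.

(** * Minimum distance and surjectivity of the syndrome map *)

Definition syn u : quad :=
  (syndrome u (@Ordinal 4 0 isT), syndrome u (@Ordinal 4 1 isT),
   syndrome u (@Ordinal 4 2 isT), syndrome u (@Ordinal 4 3 isT)).

(** As a function of i the product of brackets is the cubic form with zeros x, y, z. Summing its
    monomials against [u] produces the syndrome entries. *)
Lemma syn_pol u x y z :
  pol (syn u) x y z = \sum_i u i * (br x i * br y i * br z i).
Proof.
rewrite /pol /polU /polV /syn /syndrome !mulr_sumr.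
rewrite -!sumrN -?big_split !mulr_sumr /= -?sumrN -?big_split /=.
apply: eq_bigr => i _; rewrite !pcolE /br /=; ring.
Qed.

Definition supp u : {set pt} := [set i | u i != 0].

Lemma wtE u : wt u = #|supp u|. Proof. by []. Qed.

Lemma suppP u S i : supp u \subset S -> i \notin S -> u i = 0.
Proof.
by move=> /subsetP H; apply: contraNeq => ui; apply: H; rewrite inE.
Qed.

Definition vsub u v : vec := [ffun i => u i - v i].
Lemma syn_sub u v : syn u = syn v -> syn (vsub u v) = (0,0,0,0).
Proof.
have E k : syndrome (vsub u v) k = syndrome u k - syndrome v k.
  rewrite /syndrome -sumrB; apply: eq_bigr => i _.
  by rewrite ffunE mulrBl.
by rewrite /syn !E => -[-> -> -> ->]; rewrite !subrr.
Qed.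

Lemma pol0 x y z : pol (0,0,0,0) x y z = 0.
Proof. by rewrite /pol /polU /polV; ring. Qed.

(** The three points may coincide, so a smaller set is padded with any point [d] other than i. *)
Lemma three_cover A i : (#|A| <= 3)%N -> i \notin A ->
  exists x y z, [/\ x != i, y != i, z != i & A \subset [set x; y; z]].
Proof.
move=> cA iA; have [d di] : exists d : pt, d != i.
  by case: i {iA} => [a|]; [exists None | exists (Some 0)].
have dn k : nth d (enum A) k != i.
  have [lt|ge] := ltnP k (size (enum A)); last by rewrite nth_default.
  by apply: contraNneq iA => <-; rewrite -mem_enum mem_nth.
exists (nth d (enum A) 0), (nth d (enum A) 1), (nth d (enum A) 2); split=> //.
apply/subsetP => j; rewrite -mem_enum !inE; move: cA; rewrite cardE.
case: (enum A) => [|e1 [|e2 [|e3 [|]]]] //= _; rewrite !inE -?orbA //.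
- by move=> ->.
- by move=> /orP [] ->; rewrite ?orbT.
Qed.

(* Test the vanishing syndrome against a cubic form with zeros at all but one
   point of the support. *)
Lemma code_mindist u : syn u = (0,0,0,0) -> (wt u <= 4)%N -> u = [ffun=> 0].
Proof.
move=> s0 w4; apply/ffunP => i; rewrite ffunE; apply/eqP/negPn/negP => ui.
have iS : i \in supp u by rewrite inE.
move: w4; rewrite wtE (cardsD1 i) iS ltnS => w3.
have [||x [y [z [xi yi zi sub]]]] := @three_cover (supp u :\ i) i => //.
  by rewrite !inE eqxx.
have := syn_pol u x y z; rewrite s0 pol0 (bigD1 i) //= big1 ?addr0.
  move/esym/eqP; rewrite !mulf_eq0 !br_eq0 (negbTE ui) /=.
  by rewrite (negbTE xi) (negbTE yi) (negbTE zi).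
move=> j ji; have [jS|] := boolP (j \in supp u); last first.
  by rewrite inE negbK => /eqP ->; rewrite mul0r.
have /(subsetP sub) : j \in supp u :\ i by rewrite !inE ji; move: jS; rewrite inE.
rewrite !inE -orbA => /or3P [] /eqP ->; rewrite brxx ?mul0r ?mulr0 //.
- by rewrite mul0r mulr0.
Qed.

Lemma supp_vsub u v : supp (vsub u v) \subset supp u :|: supp v.
Proof.
apply/subsetP => i; rewrite !inE ffunE; apply: contraR.
by rewrite negb_or !negbK => /andP[/eqP-> /eqP->]; rewrite subrr.
Qed.

Lemma vsub_eq0 u v : vsub u v = [ffun=> 0] -> u = v.
Proof.
move=> /ffunP H; apply/ffunP => i; have := H i; rewrite !ffunE.
by move/eqP; rewrite subr_eq0 => /eqP.
Qed.

Lemma syn_inj S u v : (#|S| <= 4)%N -> supp u \subset S -> supp v \subset S ->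
  syn u = syn v -> u = v.
Proof.
move=> S4 uS vS /syn_sub E; apply: vsub_eq0; apply: code_mindist => //.
rewrite wtE; apply: leq_trans S4; apply: subset_leq_card.
by apply: subset_trans (supp_vsub u v) _; rewrite subUset uS vS.
Qed.

Lemma syn_inj_wt u v : (wt u + wt v <= 4)%N -> syn u = syn v -> u = v.
Proof.
move=> w4; apply: (@syn_inj (supp u :|: supp v)); rewrite ?subsetUl ?subsetUr //.
by apply: leq_trans w4; rewrite !wtE cardsU leq_subr.
Qed.

Lemma card_supp_sub S : #|[set u | supp u \subset S]| = (q ^ #|S|)%N.
Proof.
rewrite -(card_pffun_on 0 (mem S) (mem F)).
apply: eq_card => u; rewrite inE; apply/subsetP/pffun_onP => /=.
  by move=> H; split=> //; apply/subsetP => i; rewrite unfold_in => ui; apply: H; rewrite inE.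
by case=> /subsetP H _ i; rewrite inE => ui; apply: H; rewrite unfold_in.
Qed.

Lemma card_quad : #|quad| = (q ^ 4)%N.
Proof. by rewrite !card_prod !expnS expn0 muln1 !mulnA. Qed.

(** The syndrome map is injective on vectors supported in S, and there are [q ^ 4] of these, as many
    as syndromes. *)
Lemma syn_surj4 S s : #|S| = 4%N -> exists2 u, supp u \subset S & syn u = s.
Proof.
move=> S4; pose D := [set u | supp u \subset S].
have : syn @: D = [set: quad].
  apply/eqP; rewrite eqEcard subsetT cardsT card_quad card_in_imset.
    by rewrite card_supp_sub S4 leqnn.
  by move=> u v; rewrite !inE => uS vS; apply: (@syn_inj S); rewrite ?S4.
by move/setP/(_ s); rewrite inE => /imsetP [u]; rewrite inE => uS ->; exists u.
Qed.

Lemma exists_subset_card (T : finType) (B : {set T}) k : (k <= #|B|)%N ->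
  exists2 A : {set T}, A \subset B & #|A| = k.
Proof.
move=> kB; have : (0 < #|[set A : {set T} | A \subset B & #|A| == k]|)%N.
  by rewrite cards_draws bin_gt0.
by case/card_gt0P => A; rewrite inE => /andP[AB /eqP]; exists A.
Qed.

Lemma syn_surj S s : (4 <= #|S|)%N -> exists2 u, supp u \subset S & syn u = s.
Proof.
case/exists_subset_card => A AS /(syn_surj4 s) [u uA us].
by exists u => //; apply: subset_trans AS.
Qed.

(** * Fibres of the syndrome map with restricted support *)

Definition fib s : {set vec} := [set u | syn u == s].
Definition fibS s S : {set vec} := [set u in fib s | supp u \subset S].

Lemma syn_add u v k : syndrome (vadd u v) k = syndrome u k + syndrome v k.
Proof.
rewrite /syndrome -big_split; apply: eq_bigr => i _.
by rewrite ffunE mulrDl.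
Qed.

(** Translation by a vector supported in S whose syndrome is the difference of [s'] and [s] injects
    one fibre into the other. *)
Lemma fibS_card_le s s' S : (4 <= #|S|)%N -> (#|fibS s S| <= #|fibS s' S|)%N.
Proof.
move=> S4; case: s => [[[s0 s1] s2] s3]; case: s' => [[[t0 t1] t2] t3].
have [v vS vs] := syn_surj (t0-s0,t1-s1,t2-s2,t3-s3) S4.
rewrite -(card_imset (fibS (s0,s1,s2,s3) S) (f := vadd v)); last first.
  move=> u u' /ffunP H; apply/ffunP => i; have := H i; rewrite !ffunE.
  exact: addrI.
apply: subset_leq_card; apply/subsetP => _ /imsetP [u + ->].
rewrite !inE => /andP[/eqP us uS]; apply/andP; split; last first.
  apply/subsetP => i; rewrite !inE ffunE; apply: contraR => iS.
  by rewrite (suppP vS iS) (suppP uS iS) addr0.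
move: us vs; rewrite /syn !syn_add => -[-> -> -> ->] [-> -> -> ->].
by rewrite !subrK.
Qed.

Lemma fibS_card_eq s s' S : (4 <= #|S|)%N -> #|fibS s S| = #|fibS s' S|.
Proof. by move=> S4; apply/eqP; rewrite eqn_leq !fibS_card_le. Qed.

Lemma fibS_card_le1 s S : (#|S| <= 4)%N -> (#|fibS s S| <= 1)%N.
Proof.
move=> S4; apply/card_le1P => u; rewrite !inE => /andP[/eqP us uS] v.
rewrite !inE; apply/idP/eqP => [/andP[/eqP vs vS]|->]; last by rewrite us eqxx.
by apply: (syn_inj S4) => //; rewrite vs us.
Qed.

Lemma card_pt : #|{: pt}| = q.+1. Proof. exact: card_option. Qed.

Lemma pol_zero_linear s x y : (forall z, pol s x y z = 0) ->
  polU s x y = 0 /\ polV s x y = 0.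
Proof.
move=> H; have := H (Some 0); have := H None.
rewrite /pol /= !mul0r mul1r mul1r sub0r subr0 => /eqP; rewrite oppr_eq0.
by move=> /eqP -> ->.
Qed.

(* [s] lies on the secant through x and y, or on the tangent at x when x = y. *)
Definition sec s x y := (polU s x y == 0) && (polV s x y == 0).

Lemma secP s x y : reflect (forall z, pol s x y z = 0) (sec s x y).
Proof.
apply: (iffP andP) => [[/eqP U0 /eqP V0] z|/pol_zero_linear[-> ->]] //.
by rewrite /pol U0 V0 !mulr0 subrr.
Qed.

Lemma set_notin S : (#|S| < q.+1)%N -> exists z, z \notin S.
Proof.
rewrite -card_pt => lt; have /card_gt0P [z] : (0 < #|~: S|)%N.
  by rewrite cardsCs setCK subn_gt0.
by rewrite inE; exists z.
Qed.

Lemma card_setU1 S (x : pt) : x \notin S -> #|x |: S| = #|S|.+1.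
Proof. by move=> xS; rewrite cardsU1 xS. Qed.

Lemma syn_pol_supp u S x y z : supp u \subset S ->
  pol (syn u) x y z = \sum_(i in S) u i * (br x i * br y i * br z i).
Proof.
move=> uS; rewrite syn_pol [RHS]big_mkcond /=; apply: eq_bigr => i _.
by case: ifPn => // /(suppP uS) ->; rewrite mul0r.
Qed.

Hypothesis hq : (5 <= q)%N.

(** With a fourth point w allowed, a solution [u] exists. Testing it against the cubic form with
    zeros x, y, z leaves only the term at w, so T_s(x, y, z) = 0 forces [u w = 0]. *)
Lemma fibS3 s x y z : x != y -> x != z -> y != z ->
  #|fibS s [set x; y; z]| = (pol s x y z == 0).
Proof.
move=> xy xz yz; set S := [set x; y; z].
have cS : #|S| = 3%N by rewrite /S -setUA card_setU1 ?cards2 ?yz // !inE negb_or xy xz.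
have le1 : (#|fibS s S| <= 1)%N by apply: fibS_card_le1; rewrite cS.
have [w wS] : exists w, w \notin S by apply: set_notin; rewrite cS; lia.
have [/eqP p0|/negP p0] := boolP (pol s x y z == 0).
  apply/eqP; rewrite eqn_leq le1 /=; apply/card_gt0P.
  have [|u uS us] := @syn_surj (w |: S) s; first by rewrite card_setU1 // cS.
  exists u; rewrite !inE us eqxx /=.
  suff uw : u w = 0.
    apply/subsetP => i ui; have := subsetP uS _ ui; rewrite in_setU1.
    by case/orP => // /eqP iw; move: ui; rewrite inE iw uw eqxx.
  move: p0; rewrite -us (syn_pol_supp _ _ _ uS) big_setU1 //= big1 ?addr0.
    move/eqP; rewrite !mulf_eq0 !br_eq0 => /orP[/eqP //|].
    by move: wS; rewrite !inE !(eq_sym w) => /negbTE ->.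
  move=> i; rewrite !inE -orbA => /or3P [] /eqP ->; rewrite brxx ?mul0r ?mulr0 //.
  by rewrite mul0r mulr0.
apply/eqP; rewrite -leqn0 leqNgt; apply/negP => /card_gt0P [u].
rewrite !inE => /andP[/eqP us uS]; apply: p0; rewrite -us (syn_pol_supp _ _ _ uS).
apply/eqP; rewrite big1 // => i.
rewrite !inE -orbA => /or3P [] /eqP ->; rewrite brxx ?mul0r ?mulr0 //.
by rewrite mul0r mulr0.
Qed.

(** Two auxiliary points z and w are added to the support. Evaluating T_s(x, y, -) at z isolates
    [u w], and evaluating it at w isolates [u z]. *)
Lemma fibS2 s x y : x != y -> #|fibS s [set x; y]| = sec s x y.
Proof.
move=> xy; set S := [set x; y].
have cS : #|S| = 2%N by rewrite cards2 xy.
have le1 : (#|fibS s S| <= 1)%N by apply: fibS_card_le1; rewrite cS.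
have [/secP p0|/secP p0] := boolP (sec s x y).
  have [z zS] : exists z, z \notin S by apply: set_notin; rewrite cS; lia.
  have czS : #|z |: S| = 3%N by rewrite card_setU1 // cS.
  have [w wS] : exists w, w \notin z |: S by apply: set_notin; rewrite czS; lia.
  apply/eqP; rewrite eqn_leq le1 /=; apply/card_gt0P.
  have [|u uS us] := @syn_surj (w |: (z |: S)) s; first by rewrite card_setU1 // czS.
  exists u; rewrite !inE us eqxx /=.
  have {}p0 (v : pt) : u w * (br x w * br y w * br v w) + u z * (br x z * br y z * br v z) = 0.
    rewrite -[RHS](p0 v) -us (syn_pol_supp _ _ _ uS) big_setU1 //= big_setU1 //=.
    rewrite [X in _ + (_ + X)]big1 ?addr0 // => i.
    by rewrite !inE => /orP [] /eqP ->; rewrite brxx ?mul0r ?mulr0 // mul0r mulr0.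
  move: wS zS; rewrite !inE !negb_or => /and3P[wz wx wy] /andP[zx zy].
  have uw : u w = 0.
    have /eqP := p0 z; rewrite brxx !mulr0 addr0 !mulf_eq0 !br_eq0.
    by rewrite !(eq_sym _ w) (negbTE wx) (negbTE wz) (negbTE wy) !orbF => /eqP.
  have uz : u z = 0.
    have /eqP := p0 w; rewrite brxx !mulr0 add0r !mulf_eq0 !br_eq0 (negbTE wz).
    by rewrite !(eq_sym _ z) (negbTE zx) (negbTE zy) !orbF => /eqP.
  apply/subsetP => i ui; have := subsetP uS _ ui; rewrite !in_setU1 => /or3P[] //.
  - by move=> /eqP iw; move: ui; rewrite inE iw uw eqxx.
  - by move=> /eqP iw; move: ui; rewrite inE iw uz eqxx.
apply/eqP; rewrite -leqn0 leqNgt; apply/negP => /card_gt0P [u].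
rewrite !inE => /andP[/eqP us uS]; apply: p0 => z; rewrite -us (syn_pol_supp _ _ _ uS).
rewrite big1 // => i.
by rewrite !inE => /orP [] /eqP ->; rewrite brxx ?mul0r ?mulr0 // mul0r mulr0.
Qed.

End TwistedCubic.

(** * Sums over subsets *)

Section SetSums.
Local Open Scope nat_scope.

Lemma bin2_mul2 (n : nat) : (2 * 'C(n.+1, 2) = n.+1 * n)%N.
Proof. by rewrite mulnC (bin_ffact n.+1 2) ffactnSr ffactn1 subSS subn0. Qed.

Lemma bin3_mul6 (n : nat) : (6 * 'C(n.+1, 3) = n.+1 * n * n.-1)%N.
Proof.
by rewrite mulnC (bin_ffact n.+1 3) !ffactnSr ffactn0 mul1n subn0 !subSS subn0 subn1.
Qed.

(** A superset of A is determined by its part outside A. *)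
Lemma card_supersets (T : finType) (A : {set T}) m :
  #|[set S : {set T} | #|S| == m & A \subset S]| =
  if #|A| <= m then 'C(#|T| - #|A|, m - #|A|) else 0.
Proof.
case: leqP => [le|lt]; last first.
  apply: eq_card0 => S; rewrite !inE; apply/negP => /andP[/eqP Sm AS].
  by move: lt; rewrite -Sm ltnNge subset_leq_card.
have -> : #|T| - #|A| = #|~: A| by rewrite -(cardsC A) addKn.
rewrite -cards_draws.
rewrite -(card_in_imset (f := fun B => A :|: B)
  (D := [set B : {set T} | B \subset ~: A & #|B| == m - #|A|])).
  apply: eq_card => S; rewrite !inE; apply/andP/imsetP.
    case=> /eqP Sm AS; exists (S :\: A).
      by rewrite inE setDE subsetIr -setDE cardsD (setIidPr AS) Sm eqxx.
    by rewrite setDE setUIr setUCr setIT; apply/esym/setUidPr.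
  case=> B; rewrite inE => /andP[BA /eqP Bm] ->; rewrite subsetUl.
  rewrite cardsU Bm.
  have /eqP -> : A :&: B == set0 by rewrite setI_eq0 disjoint_sym disjoints_subset.
  by rewrite cards0 subn0 subnKC.
move=> B C; rewrite !inE => /andP[BA _] /andP[CA _] E.
have K (D : {set T}) : D \subset ~: A -> (A :|: D) :\: A = D.
  by move=> DA; rewrite setDUl setDv set0U; apply/setDidPl; rewrite disjoints_subset.
by rewrite -(K B) // -(K C) // E.
Qed.

(** Both sides sum over pairs of a set and a point of it; on the right the point is removed from the
    set. Iteration turns sums over sets into sums over ordered tuples. *)
Lemma sum_sets_pointed (T : finType) (g : {set T} -> nat) k :
  k.+1 * \sum_(S : {set T} | #|S| == k.+1) g S =
  \sum_x \sum_(S : {set T} | #|S| == k) (if x \notin S then g (x |: S) else 0).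
Proof.
transitivity (\sum_x \sum_(S : {set T} | (#|S| == k.+1) && (x \in S)) g S).
  rewrite (exchange_big_dep (fun S : {set T} => #|S| == k.+1)) /=.
    rewrite big_distrr; apply: eq_bigr => S /eqP cS /=.
    by under eq_bigl do rewrite cS eqxx /=; rewrite sum_nat_const cS.
  by move=> x S _ /andP[].
apply: eq_bigr => x _; rewrite -big_mkcondr /=.
rewrite (reindex_onto (fun S => x |: S) (fun S => S :\ x)); last first.
  by move=> S /andP[_ xS]; rewrite setD1K.
apply: eq_bigl => S; rewrite setU11 andbT.
have [xS|xS] := boolP (x \in S); last by rewrite cardsU1 xS setU1K // eqxx !andbT.
rewrite andbF; apply/negbTE; rewrite negb_and; apply/orP; right.
by apply: contraTneq xS => <-; rewrite !inE eqxx.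
Qed.

Lemma sum_sets0 (T : finType) (g : {set T} -> nat) :
  \sum_(S : {set T} | #|S| == 0) g S = g set0.
Proof. by rewrite (big_pred1 set0) // => S; rewrite cards_eq0. Qed.

Lemma sum_sets2 (T : finType) (g : {set T} -> nat) :
  2 * \sum_(S : {set T} | #|S| == 2) g S = \sum_x \sum_(y | x != y) g [set x; y].
Proof.
rewrite sum_sets_pointed; apply: eq_bigr => x _.
rewrite -[LHS]mul1n sum_sets_pointed [RHS]big_mkcond; apply: eq_bigr => y _.
by rewrite sum_sets0 !inE /= orbF setU0.
Qed.

Lemma sum_sets3 (T : finType) (g : {set T} -> nat) :
  6 * \sum_(S : {set T} | #|S| == 3) g S =
  \sum_x \sum_(y | x != y) \sum_(z | (x != z) && (y != z)) g [set x; y; z].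
Proof.
rewrite (_ : 6 = 2 * 3) // -mulnA sum_sets_pointed big_distrr /=.
apply: eq_bigr => x _.
rewrite (sum_sets2 (fun S => if x \notin S then g (x |: S) else 0)) [RHS]big_mkcond.
apply: eq_bigr => y _; rewrite big_mkcond; case: ifP => xy.
  rewrite [RHS]big_mkcond; apply: eq_bigr => z _; rewrite !inE negb_or xy /=.
  by rewrite setUA; case: eqP; case: eqP.
rewrite big1 // => z _; rewrite !inE negb_or xy /=.
by case: ifP.
Qed.

Lemma bigminn_le (I : eqType) (r : seq I) (P : pred I) (f : I -> nat) n i :
  i \in r -> P i -> \big[minn/n]_(j <- r | P j) f j <= f i.
Proof.
elim: r => // a r IH; rewrite inE big_cons => /orP[/eqP <- ->|ir Pi].
  exact: geq_minl.
by case: ifP => _; rewrite ?geq_min IH ?orbT.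
Qed.

Lemma bigminn_attained (I : Type) (r : seq I) (P : pred I) (f : I -> nat) n :
  let m := \big[minn/n]_(j <- r | P j) f j in m = n \/ exists2 i, P i & f i = m.
Proof.
apply: (big_rec (fun m => m = n \/ exists2 i, P i & f i = m)); first by left.
move=> i m Pi IH; rewrite /minn; case: ifP => _; [right; by exists i|exact: IH].
Qed.

End SetSums.

(** * Weight distributions from incidence counts *)

Section Counting.
Variable F : finFieldType.
Hypothesis hq : (5 <= #|F|)%N.
Local Notation q := #|F|.
Local Notation pt := (option F).
Local Notation vec := (vec F).
Local Notation quad := (quad F).
Implicit Types (x y z : pt) (u v : vec) (S : {set pt}) (s : quad).
Local Open Scope ring_scope.
Local Open Scope nat_scope.

Definition Bw s w : nat := #|[set u in fib s | wt u == w]|.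
Definition Am s m : nat := \sum_(S : {set pt} | #|S| == m) #|fibS s S|.

(** A vector of weight w is counted once for each m-set containing its support. *)
Lemma AmE s m : Am s m = \sum_(w < m.+1) Bw s w * 'C(q.+1 - w, m - w).
Proof.
transitivity (\sum_(u in fib s) if wt u <= m then 'C(q.+1 - wt u, m - wt u) else 0).
  transitivity (\sum_(S : {set pt} | #|S| == m) \sum_(u in fib s) (supp u \subset S : nat)).
    apply: eq_bigr => S _; rewrite -sum1_card /fibS.
    rewrite (eq_bigl (fun u => (u \in fib s) && (supp u \subset S))) ?big_mkcondr /=.
      by apply: eq_bigr => u _; case: ifP.
    by move=> u; rewrite inE.
  rewrite exchange_big; apply: eq_bigr => u _ /=; rewrite !wtE -card_pt -card_supersets.
  rewrite -sum1_card [RHS]big_mkcond [LHS]big_mkcond /=; apply: eq_bigr => S _.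
  by rewrite inE; case: eqP => //=; case: ifP.
rewrite -big_mkcondr (partition_big (fun u => inord (wt u) : 'I_m.+1) xpredT) //=.
apply: eq_bigr => w _; rewrite -sum_nat_const.
rewrite (eq_bigl (fun u => (u \in fib s) && (wt u == w))); last first.
  move=> u; rewrite -andbA; congr andb; apply/andP/eqP.
    by case=> le /eqP <-; rewrite inordK.
  by move=> E; have := ltn_ord w; rewrite -{1}E ltnS => ->; split=> //; rewrite E inord_val.
rewrite (eq_bigr (fun=> 'C(q.+1 - w, m - w))); last by move=> u /andP[_ /eqP ->].
by apply: eq_bigl => u; rewrite inE.
Qed.

Lemma wt_le u : wt u <= q.+1.
Proof. by rewrite wtE -card_pt max_card. Qed.

Lemma Am_const s s' m : 4 <= m -> Am s m = Am s' m.
Proof.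
by move=> m4; apply: eq_bigr => S /eqP cS; apply: fibS_card_eq; rewrite cS.
Qed.

(** By [AmE] the passage from the numbers [Bw s w] to the numbers [Am s m] is triangular with unit
    diagonal, hence invertible by induction on the weight. *)
Lemma wdist_fibP s s' :
  wdist (fib s) = wdist (fib s') <-> (forall m, m <= 3 -> Am s m = Am s' m).
Proof.
split=> [E m m3|E].
  rewrite !AmE; apply: eq_bigr => w _; congr muln.
  have wn : w < (#|{: pt}|).+1 by rewrite card_pt; have := ltn_ord w; lia.
  have := congr1 (nth 0 ^~ w) E; rewrite /wdist !(nth_map 0) ?size_iota //.
  by rewrite !nth_iota // add0n.
have {}E m : Am s m = Am s' m.
  by have [/E//|] := leqP m 3; exact: Am_const.
apply: eq_map => w; elim/ltn_ind: w => m IH.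
have := E m; rewrite !AmE !big_ord_recr /= !subnn !bin0 !muln1.
rewrite (eq_bigr (fun w : 'I_m => Bw s' w * 'C(q.+1 - w, m - w))).
  by move/addnI.
by move=> w _; rewrite /Bw IH.
Qed.

Lemma quad_syn s : exists u, syn u = s.
Proof.
have [|u _ us] := @syn_surj F [set: pt] s; first by rewrite cardsT card_pt; lia.
by exists u.
Qed.

Lemma fib_inj : injective (@fib F).
Proof.
move=> s s' E; have [u us] := quad_syn s.
have : u \in fib s by rewrite inE us.
by rewrite E inE us => /eqP.
Qed.

Lemma syndrome0P u : reflect (syn u = (0,0,0,0)%R) [forall k, syndrome u k == 0%R].
Proof.
apply: (iffP forallP) => [H|[H0 H1 H2 H3] k].
  by rewrite /syn; do 3?[congr pair]; apply/eqP.
apply/eqP; case: k => [[|[|[|[|k]]]] Hk] //.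
Qed.

Lemma coset_fib v : coset v = fib (syn v).
Proof.
apply/setP => u; rewrite inE; apply/imsetP/eqP.
  case=> c; rewrite inE => /syndrome0P c0 ->.
  by move: c0; rewrite /syn !syn_add => -[-> -> -> ->]; rewrite !addr0.
move=> uv; exists (vsub u v).
  by rewrite inE; apply/syndrome0P/syn_sub.
by apply/ffunP => i; rewrite !ffunE addrC subrK.
Qed.

Lemma cosetsE : cosets F = [set fib s | s : quad].
Proof.
apply/setP => X; apply/imsetP/imsetP => -[v _ ->].
  by exists (syn v) => //; rewrite coset_fib.
by have [u <-] := quad_syn v; exists u => //; rewrite coset_fib.
Qed.

Lemma cosetsP X : X \in cosets F -> exists s, X = fib s.
Proof. by rewrite cosetsE => /imsetP[s _ ->]; exists s. Qed.

Definition cw s := coset_wt (fib s).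

(** Cosets are counted through their syndromes, since [fib] is injective. *)
Lemma ncosE j d : ncos F j d = #|[set s | (cw s == j) && (wdist (fib s) == d)]|.
Proof.
rewrite -(card_imset _ fib_inj); apply: eq_card => X; rewrite inE cosetsE.
apply/andP/imsetP => [[/imsetP[s _ ->] H]|[s + ->]].
  by exists s => //; rewrite inE.
by rewrite inE => H; split=> //; apply: imset_f.
Qed.

Lemma cw_le u : cw (syn u) <= wt u.
Proof. by apply: bigminn_le; rewrite ?mem_index_enum // inE. Qed.

Lemma cw_attained s : exists2 u, syn u = s & wt u = cw s.
Proof.
have [E|[u us E]] := bigminn_attained (index_enum vec) (mem (fib s)) (@wt F) #|{: pt}|.
  (* If the minimum is the default value q + 1, an upper bound for all weights, then any vector of
     the fibre attains it. *)
  have [u us] := quad_syn s; exists u => //; apply/eqP; rewrite eqn_leq -{2}us cw_le andbT.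
  by rewrite [cw s]E card_pt wt_le.
exists u; last exact: E.
by move: us; rewrite /= inE => /eqP.
Qed.

Lemma Bw_lt s w : w < cw s -> Bw s w = 0.
Proof.
move=> lt; apply: eq_card0 => u; rewrite !inE; apply/negP => /andP[/eqP us /eqP uw].
by have := cw_le u; rewrite us uw leqNgt lt.
Qed.

(** A vector of weight w and one of minimal weight differ by a codeword of weight at most 4, so they
    coincide. *)
Lemma Bw_low s w : w + cw s <= 4 -> Bw s w = (w == cw s).
Proof.
have [u us uw] := cw_attained s => w4.
rewrite /Bw (eq_card (B := [pred v | (v == u) && (w == cw s)])); last first.
  move=> v; rewrite !inE; apply/andP/andP => [[/eqP vs /eqP vw]|[/eqP -> /eqP ->]].
    have vu : v = u by apply: syn_inj_wt; rewrite ?vs ?us // vw uw.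
    by rewrite vu eqxx -vw vu uw eqxx.
  by rewrite us uw !eqxx.
case: (w == cw s) => /=; last by apply: eq_card0 => v; rewrite inE andbF.
by rewrite -(card1 u); apply: eq_card => v; rewrite !inE ?andbT.
Qed.

Lemma Am1E s : Am s 1 = q.+1 * Bw s 0 + Bw s 1.
Proof. by rewrite AmE !big_ord_recr big_ord0 /= bin0 muln1 subn0 bin1 mulnC. Qed.

Lemma Am2E s : 2 * Am s 2 = q.+1 * q * Bw s 0 + 2 * q * Bw s 1 + 2 * Bw s 2.
Proof.
have := bin2_mul2 q; rewrite AmE !big_ord_recr big_ord0; move: (bin1 q) (bin0 (q.+1 - 2)).
move: binomial => c; rewrite /= subnn subn1 subn0 [_ - 1]/= => -> -> E.
by rewrite add0n !mulnDr -E; ring.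
Qed.

(* [s] lies on the osculating plane at z. *)
Definition osc s z := pol s z z z == 0%R.
Definition rt s : nat := \sum_z osc s z.
Definition tg s : nat := \sum_x sec s x x.

(** A nonzero linear form has one zero on P^1; the zero form vanishes at all q + 1 points. *)
Lemma sum_lin (U V : F) :
  \sum_(z : pt) ((pa z * U - pb z * V)%R == 0%R) = (q * ((U == 0%R) && (V == 0%R))).+1.
Proof.
have [->|V0] := eqVneq V 0%R.
  have [->|U0] := eqVneq U 0%R.
    rewrite (eq_bigr (fun=> 1)) ?sum1_card ?card_pt ?muln1 //.
    by move=> z _; rewrite !mulr0 subrr eqxx.
  rewrite muln0 (bigD1 None) //= big1; first by rewrite mul0r mulr0 subrr eqxx.
  by case=> // a _; rewrite /= mul1r mulr0 subr0 (negbTE U0).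
rewrite andbF muln0 (bigD1 (Some (U / V)%R)) //= big1.
  by rewrite mul1r mulfVK // subrr eqxx.
case=> [a|] /=; last by rewrite mul0r mul1r sub0r oppr_eq0 (negbTE V0).
move=> ne; rewrite mul1r subr_eq0; case: eqP => // E; case/eqP: ne; congr Some.
by rewrite E mulfK.
Qed.

Lemma sum_pol s x y : \sum_z (pol s x y z == 0%R) = (q * sec s x y).+1.
Proof. exact: sum_lin. Qed.

Lemma sum_sec s : \sum_x \sum_(y | x != y) sec s x y = 2 * Am s 2.
Proof.
rewrite sum_sets2; apply: eq_bigr => x _; apply: eq_bigr => y xy.
by rewrite fibS2.
Qed.

Lemma sum_pol_neq s :
  \sum_x \sum_(y | x != y) \sum_(z | (x != z) && (y != z)) (pol s x y z == 0%R) = 6 * Am s 3.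
Proof.
rewrite sum_sets3; apply: eq_bigr => x _; apply: eq_bigr => y xy.
by apply: eq_bigr => z /andP[xz yz]; rewrite fibS3.
Qed.

(** For each x the zeros y of T_s(x, x, -) are counted by [sum_lin]; y = x is among them exactly
    when x is an osculation point. *)
Lemma sum_pol_tan s :
  \sum_x \sum_(y | x != y) (pol s x x y == 0%R) + rt s = q.+1 + q * tg s.
Proof.
rewrite /rt /tg -big_split big_distrr /= -card_pt -sum1_card -big_split /=.
apply: eq_bigr => x _; rewrite add1n -sum_pol [in RHS](bigD1 x) //= addnC.
by congr addn; apply: eq_bigl => y; rewrite eq_sym.
Qed.

(** For each ordered pair x <> y all zeros z of T_s(x, y, -) are counted. The terms z = x and z = y
    give, by symmetry of T_s, two copies of the tangent sum [D]; the others give [6 * Am s 3]. *)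
Lemma triple_count s :
  6 * Am s 3 + 2 * (q.+1 + q * tg s) = q.+1 * q + 2 * q * Am s 2 + 2 * rt s.
Proof.
rewrite -sum_pol_tan.
set D := \sum_x _.
have D' : \sum_x \sum_(y | x != y) (pol s y y x == 0%R) = D.
  rewrite (exchange_big_dep xpredT) //=; apply: eq_bigr => x _.
  by apply: eq_bigl => y; rewrite eq_sym.
suff : 6 * Am s 3 + D + D = q.+1 * q + 2 * q * Am s 2 by lia.
rewrite -{2}D' -sum_pol_neq /D -!big_split /=.
rewrite -mulnA mulnCA -sum_sec big_distrr /= -card_pt.
have -> : #|{: pt}| * q = \sum_(x : pt) \sum_(y | x != y) 1.
  rewrite -sum_nat_const; apply: eq_bigr => x _.
  have := cardC1 x; rewrite card_pt /= => <-; rewrite -sum1_card.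
  by apply: eq_bigl => y; rewrite inE eq_sym.
rewrite -big_split; apply: eq_bigr => x _ /=.
rewrite big_distrr -!big_split /=; apply: eq_bigr => y xy.
have yx : y != x by rewrite eq_sym.
rewrite add1n -sum_pol [RHS](bigD1 x) //= [in RHS](bigD1 y) //=.
rewrite [in RHS](eq_bigl (fun z => (x != z) && (y != z))); last first.
  by move=> z; rewrite !(eq_sym z).
have -> : pol s x y x = pol s x x y by rewrite polAC.
have -> : pol s x y y = pol s y y x by rewrite polC polAC.
by ring.
Qed.

End Counting.

(** * Points on the cubic, on secants and on tangents *)

Section Classes.
Local Open Scope ring_scope.
Variable F : finFieldType.
Hypothesis hq : (5 <= #|F|)%N.
Local Notation q := #|F|.
Local Notation pt := (option F).
Local Notation vec := (vec F).
Local Notation quad := (quad F).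
Implicit Types (x y z : pt) (u : vec) (S : {set pt}) (s : quad).

Lemma syn0 : syn [ffun=> 0] = (0, 0, 0, 0) :> quad.
Proof.
have E k : syndrome ([ffun=> 0] : vec) k = 0.
  by apply: big1 => i _; rewrite ffunE mul0r.
by rewrite /syn !E.
Qed.

Lemma cw_eq0 s : (cw s == 0%N) = (s == (0, 0, 0, 0)).
Proof.
apply/eqP/eqP => [c0|->].
  have [u us] := cw_attained hq s; rewrite c0 wtE => /cards0_eq E.
  rewrite -us -syn0; congr syn; apply/ffunP => i; rewrite ffunE.
  by apply: (@suppP _ _ set0); rewrite ?E ?inE.
have := cw_le ([ffun=> 0] : vec); rewrite syn0 wtE.
suff -> : supp ([ffun=> 0] : vec) = set0 by rewrite cards0 leqn0 => /eqP.
by apply/setP => i; rewrite !inE ffunE eqxx.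
Qed.

Lemma cw1_pol s : cw s = 1%N -> exists (c : F) (w : pt),
  c != 0 /\ forall x y z, pol s x y z = c * (br x w * br y w * br z w).
Proof.
move=> c1; have [u us] := cw_attained hq s; rewrite c1 wtE => /eqP /cards1P[w uw].
exists (u w), w; split; first by have := set11 w; rewrite -uw inE.
by move=> x y z; rewrite -us (@syn_pol_supp _ _ [set w]) ?uw // big_set1.
Qed.

Lemma cw2_pol s : cw s = 2%N -> exists (a b : F) (v w : pt),
  [/\ a != 0, b != 0, v != w & forall x y z,
   pol s x y z = a * (br x v * br y v * br z v) + b * (br x w * br y w * br z w)].
Proof.
move=> c2; have [u us] := cw_attained hq s; rewrite c2 wtE => /eqP /cards2P [v [w [vw uw]]].
have uv i : i \in [set v; w] -> u i != 0 by rewrite -uw inE.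
exists (u v), (u w), v, w; split=> //; rewrite ?uv ?inE ?eqxx ?orbT //.
move=> x y z; rewrite -us (@syn_pol_supp _ _ [set v; w]) ?uw //.
by rewrite big_setU1 ?inE //= big_set1.
Qed.

Lemma sec_cw s x y : (3 <= cw s)%N -> x != y -> ~~ sec s x y.
Proof.
move=> c3 xy; apply/negP => sxy.
have := sum_sec hq s.
rewrite Am2E !Bw_lt ?(leq_trans _ c3) // !muln0.
by move/eqP; rewrite (bigD1 x) //= (bigD1 y) //= sxy.
Qed.

(** Cramer's rule writes z in the basis x, y of F^2, which expresses T_s(x, y, z) through T_s(x, x,
    y) and T_s(y, y, x). *)
Lemma sec_tangents s x y : x != y -> sec s x x -> sec s y y -> sec s x y.
Proof.
move=> xy /secP sx /secP sy; apply/secP => z.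
apply/eqP; rewrite -(mulrI_eq0 _ (x := br x y)); last first.
  by apply/lregP; rewrite br_neq0.
have -> : br x y * pol s x y z = br z y * pol s x x y + br x z * pol s y y x.
  by case: s {sx sy} => [[[s0 s1] s2] s3]; rewrite /pol /polU /polV /br; ring.
by rewrite sx sy !mulr0 addr0.
Qed.

Lemma tg_card s : tg s = #|[set x | sec s x x]|.
Proof.
by rewrite -sum1_card big_mkcond; apply: eq_bigr => x _; rewrite inE; case: ifP.
Qed.

Lemma rt_card s : rt s = #|[set x | osc s x]|.
Proof.
by rewrite -sum1_card big_mkcond; apply: eq_bigr => x _; rewrite inE; case: ifP.
Qed.

Lemma tg_le1 s : (3 <= cw s)%N -> (tg s <= 1)%N.
Proof.
move=> c3; rewrite tg_card leqNgt; apply/negP => /card_gt1P [x [y []]].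
rewrite !inE => sx sy xy; have := sec_tangents xy sx sy.
by apply/negP/sec_cw.
Qed.

(** Otherwise A_2 = A_3 = 0 and t <= 1, and [triple_count] would give q (q + 1) <= 2 (2 q + 1),
    which fails for q >= 5. *)
Lemma cw_le3 s : (cw s <= 3)%N.
Proof.
rewrite leqNgt; apply/negP => c4; have c3 := ltnW c4.
have A2 : (2 * Am s 2 = 0)%N.
  by rewrite Am2E !Bw_lt ?(leq_trans _ c4) // !muln0.
have A3 : Am s 3 = 0%N.
  rewrite AmE big1 // => w _; rewrite Bw_lt //; have := ltn_ord w; lia.
have := triple_count hq s; rewrite A3; have := tg_le1 c3; nia.
Qed.

(** Only w = 2 in a coset of weight 3 escapes [Bw_low], and there w lies below the minimum. *)
Lemma Bw_cw s w : (w <= 2)%N -> Bw s w = (w == cw s).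
Proof.
move=> w2; have c3 := cw_le3 s; have [le|gt] := leqP (w + cw s) 4.
  exact: Bw_low.
by rewrite Bw_lt; first case: eqP; lia.
Qed.

Lemma Am1_cw s : (Am s 1 = q.+1 * (cw s == 0) + (cw s == 1))%N.
Proof. by rewrite Am1E !Bw_cw // ![_ == cw s]eq_sym. Qed.

Lemma Am2_cw s :
  (2 * Am s 2 = q.+1 * q * (cw s == 0) + 2 * q * (cw s == 1) + 2 * (cw s == 2%N))%N.
Proof. by rewrite Am2E !Bw_cw // ![_ == cw s]eq_sym. Qed.

Lemma wdist_class s s' : cw s = cw s' ->
  wdist (fib s) = wdist (fib s') <-> Am s 3 = Am s' 3.
Proof.
move=> E; rewrite wdist_fibP //; split=> [|E3 m]; first by apply.
rewrite leq_eqVlt => /orP[/eqP -> //|m2]; rewrite !AmE; apply: eq_bigr => w _.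
by rewrite !Bw_cw ?E //; have := ltn_ord w; lia.
Qed.

Lemma rt_cw1 s : cw s = 1%N -> rt s = 1%N.
Proof.
case/cw1_pol => c [w [c0 E]]; rewrite rt_card (_ : [set x | _] = [set w]) ?cards1 //.
apply/setP => z; rewrite !inE /osc E !mulf_eq0 !br_eq0 (negbTE c0) /=.
by case: eqP.
Qed.

Lemma tg_cw1 s : cw s = 1%N -> tg s = 1%N.
Proof.
case/cw1_pol => c [w [c0 E]]; rewrite tg_card (_ : [set x | _] = [set w]) ?cards1 //.
apply/setP => z; rewrite !inE; apply/secP/eqP => [H|-> y]; last first.
  by rewrite E brxx !mul0r mulr0.
have [y yw] : exists y : pt, y != w by case: (w) => [a|]; [exists None | exists (Some 0)].
have /eqP := H y; rewrite E !mulf_eq0 !br_eq0 (negbTE c0) (negbTE yw) /= orbF orbb.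
by move/eqP.
Qed.

Lemma tg_cw2 s : cw s = 2%N -> tg s = 0%N.
Proof.
case/cw2_pol => a [b [v [w [a0 b0 vw E]]]]; rewrite tg_card; apply: eq_card0 => z.
rewrite !inE; apply/negP => /secP H.
have /eqP := H v; rewrite E brxx !mulr0 add0r !mulf_eq0 !br_eq0.
rewrite (negbTE b0) (negbTE vw) orbF orbb /=.
move=> /eqP zw.
have /eqP := H w; rewrite E brxx !mulr0 addr0 !mulf_eq0 !br_eq0 (negbTE a0) zw.
by rewrite eq_sym (negbTE vw).
Qed.

(* The zero on P^1 of the linear form with coefficients U and - V, or [None] if U = V = 0. *)
Definition linroot (U V : F) : pt := if V == 0 then None else Some (U / V).

Lemma linrootP U V : pa (linroot U V) * U - pb (linroot U V) * V = 0.
Proof.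
rewrite /linroot; case: eqP => [->|/eqP V0] /=; first by rewrite mul0r mulr0 subrr.
by rewrite mul1r mulfVK // subrr.
Qed.

(* If [s] = a P_v + b P_w, then z is an osculation point iff the ratio
   br z v / br z w is a cube root of - b / a. *)
Lemma rt_cw2 s : cw s = 2%N ->
  exists2 g : F, g != 0 & rt s = #|[set c : F | c ^+ 3 == g]|.
Proof.
case/cw2_pol => a [b [v [w [a0 b0 vw E]]]].
exists (- b / a); first by rewrite mulf_neq0 ?oppr_eq0 ?invr_eq0.
pose f c := linroot (pb v - c * pb w) (pa v - c * pa w).
have fP c : br (f c) v = c * br (f c) w.
  apply/eqP; rewrite -subr_eq0 -(linrootP (pb v - c * pb w) (pa v - c * pa w)).
  by rewrite -/(f c) /br; apply/eqP; ring.
have fw c : br (f c) w != 0.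
  have [fw|//] := eqVneq (br (f c) w) 0.
  move: (fP c); rewrite fw mulr0 => /eqP; move/eqP: fw; rewrite !br_eq0.
  by move=> /eqP -> /eqP E'; rewrite E' eqxx in vw.
rewrite rt_card -(card_imset (f := f)); last first.
  move=> c d cd; have := fP c; rewrite cd fP; by move/(mulIf (fw d)) => ->.
apply: eq_card => z; rewrite inE /osc E; apply/eqP/imsetP.
  move=> H; have zw : br z w != 0.
    apply/negP => /eqP zw; move/eqP: H; rewrite zw !mulr0 addr0 !mulf_eq0.
    rewrite (negbTE a0) !br_eq0 !orbb /=; move/eqP: zw; rewrite br_eq0.
    by move=> /eqP -> /eqP wv; rewrite wv eqxx in vw.
  exists (br z v / br z w).
    rewrite inE expr_div_n; apply/eqP; apply: (mulIf (expf_neq0 3 zw)).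
    rewrite mulfVK ?expf_neq0 //; apply: (mulfI a0).
    rewrite [RHS]mulrA [a * (_ / _)]mulrC mulfVK // mulNr.
    by apply/eqP; rewrite -subr_eq0 opprK; apply/eqP; rewrite -[RHS]H; ring.
  set c := _ / _; have zc : br z v = c * br z w by rewrite mulfVK.
  apply/eqP; rewrite -br_eq0.
  (* The Plücker relation for z, f c, v, w shows that z and f c are the same point. *)
  suff: br z (f c) * br v w == 0 by rewrite mulf_eq0 [br v w == _]br_eq0 (negbTE vw) orbF.
  have -> : br z (f c) * br v w = br z v * br (f c) w - br (f c) v * br z w.
    by rewrite /br; ring.
  by rewrite zc fP -!mulrA [br z w * _]mulrC subrr.
case=> c; rewrite inE => /eqP c3 ->; rewrite fP.
transitivity ((a * c ^+ 3 + b) * br (f c) w ^+ 3); first by ring.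
by rewrite c3 [a * (_ / _)]mulrC mulfVK // addNr mul0r.
Qed.

(** For [s] on the tangent at x, T_s(z, z, z) is the square of [br x z] times a linear form in z. If
    that form also vanished at x, then, 3 being invertible, [s] would be a multiple of the curve
    point x and lie on secants, against the coset weight. *)
Lemma tg_rt s : 3%:R != 0 :> F -> (3 <= cw s)%N -> tg s = 1%N -> rt s = 2%N.
Proof.
move=> n3 c3 t1.
have /card_gt0P [x] : (0 < #|[set x | sec s x x]|)%N by rewrite -tg_card t1.
rewrite inE /sec => /andP[/eqP Hu /eqP Hv].
suff [U [V [HQ HL]]] : exists U V,
    (forall z, pol s z z z = br x z ^+ 2 * (pa z * U - pb z * V)) /\
    pa x * U - pb x * V != 0.
  rewrite rt_card (_ : [set z | _] = [set x; linroot U V]).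
    by rewrite cards2; case: eqP => // E; rewrite E linrootP eqxx in HL.
  apply/setP => z; rewrite !inE /osc HQ mulf_eq0 expf_eq0 /= br_eq0 eq_sym.
  congr orb; rewrite -br_eq0; apply/eqP/eqP => [E|].
    have := linrootP U V; move: E HL; move: (linroot U V) => y Ez Hl Ey.
    apply/eqP; have [U0|U0] := eqVneq U 0.
      have V0 : V != 0 by apply: contraNneq Hl => ->; rewrite U0 !mulr0 subrr.
      rewrite -(mulrI_eq0 _ (x := V)); last by apply/lregP.
      suff -> : V * br z y = pa y * (pa z * U - pb z * V) - pa z * (pa y * U - pb y * V).
        by rewrite Ez Ey !mulr0 subrr.
      by rewrite /br; ring.
    rewrite -(mulrI_eq0 _ (x := U)); last by apply/lregP.
    suff -> : U * br z y = pb y * (pa z * U - pb z * V) - pb z * (pa y * U - pb y * V).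
      by rewrite Ez Ey !mulr0 subrr.
    by rewrite /br; ring.
  by move/eqP; rewrite br_eq0 => /eqP ->; rewrite linrootP.
have ns y : x != y -> ~~ sec s x y by move=> xy; apply: sec_cw.
case: s Hu Hv ns {c3 t1} => [[[s0 s1] s2] s3].
case: x => [b|]; rewrite /polU /polV /sec /= => Hu Hv ns; last first.
  have E1 : s1 = 0 by rewrite -Hu; ring.
  have E0 : s0 = 0 by rewrite -Hv; ring.
  exists s3, (3%:R * s2); split.
    by move=> z; rewrite /pol /polU /polV /br /= E0 E1; ring.
  rewrite /= mul0r mul1r sub0r oppr_eq0 mulf_neq0 //.
  have := ns (Some 0) isT; rewrite negb_and /= E1 E0 => /orP[|/negP[]].
    by apply: contraNneq => ->; apply/eqP; ring.
  by apply/eqP; ring.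
have E2 : s2 = 2%:R * b * s1 - b ^+ 2 * s0.
  by apply/eqP; rewrite -subr_eq0; apply/eqP; rewrite -[RHS]Hv; ring.
have E3 : s3 = 2%:R * b * s2 - b ^+ 2 * s1.
  by apply/eqP; rewrite -subr_eq0; apply/eqP; rewrite -[RHS]Hu; ring.
exists (3%:R * s1 - 2%:R * b * s0), s0; split.
  by move=> z; rewrite /pol /polU /polV /br /= E3 E2; ring.
have := ns None isT; rewrite /=.
apply: contraNneq => H.
have {}H : 3%:R * (s1 - b * s0) = 0 by rewrite -[RHS]H; ring.
move/eqP: H; rewrite mulf_eq0 (negbTE n3) /= subr_eq0 => /eqP H.
by apply/andP; split; apply/eqP; rewrite ?E2 H; ring.
Qed.

End Classes.

(** * Cubes in a finite field *)

Section Cubes.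
Local Open Scope ring_scope.
Variable F : finFieldType.
Local Notation q := #|F|.

Lemma three_eq0 : (3%:R == 0 :> F) = (q %% 3 == 0)%N.
Proof.
apply/eqP/eqP => [E|q3].
  have F3 : 3 \in [pchar F] by rewrite inE /= E eqxx.
  apply/eqP; rewrite (card_pprimeChar F3) -/(dvdn _ _) Euclid_dvdX //=.
  rewrite lt0n; apply: contraTneq (finNzRing_gt1 F) => n0.
  by rewrite (card_pprimeChar F3) n0.
have [p pp pF] := finPcharP F.
have : (3 %| p ^ logn p q)%N by rewrite -card_pprimeChar //; apply/eqP.
rewrite Euclid_dvdX // => /andP[]; rewrite dvdn_prime2 // => /eqP -> _.
exact: pcharf0.
Qed.

Lemma cube_inj : (q %% 3 != 1)%N -> injective (fun c : F => c ^+ 3).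
Proof.
move=> q1; suff [k E] : exists k, forall c : F, c = (c ^+ 3) ^+ k.
  by move=> c d /= cd; rewrite (E c) cd -E.
have : (q %% 3 < 3)%N by rewrite ltn_mod.
have := divn_eq q 3; set k := (q %/ 3)%N.
case: (q %% 3)%N q1 => [|[|[|]]] // _ qE _.
  by exists k => c; rewrite -exprM (_ : (3 * k = q)%N) ?expf_card //; lia.
exists (2 * k + 1)%N => c; rewrite -exprM.
have [->|c0] := eqVneq c 0; first by rewrite expr0n; case: eqP => //; lia.
apply: (mulfI c0); rewrite -exprS.
have -> : (3 * (2 * k + 1)).+1 = (q + q)%N by lia.
by rewrite exprD expf_card.
Qed.

(** Put k = (q - 1) / 3. Since X^k - 1 has at most k roots, some nonzero c has c^k <> 1, and the
    cube of c^k is c^(q - 1) = 1. *)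
Lemma cube_root1 : (q %% 3 = 1)%N -> exists2 o : F, o ^+ 3 = 1 & o != 1.
Proof.
move=> q1; have qE := divn_eq q 3; rewrite q1 in qE; set k := (q %/ 3)%N in qE.
have k0 : (0 < k)%N by have : (1 < q)%N := finNzRing_gt1 F; lia.
have [c /andP[c0 ck]] : exists c : F, (c != 0) && (c ^+ k != 1).
  apply/existsP; apply: contraT; rewrite negb_exists => /forallP H.
  have := @max_poly_roots F ('X^k - 1) (enum [set c : F | c != 0]).
  rewrite -size_poly_eq0 size_XnsubC // => /(_ isT); rewrite enum_uniq -cardE => /(_ _ isT).
  rewrite (_ : #|_| = (3 * k)%N); last first.
    rewrite (_ : [set c : F | c != 0] = [set~ 0]); last by apply/setP => c; rewrite !inE.
    by rewrite cardsC1 qE addn1 mulnC.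
  move=> A; suff : (3 * k < k.+1)%N by lia.
  apply: A; apply/allP => c; rewrite mem_enum inE => c0.
  have := H c; rewrite c0 /= negbK => /eqP E.
  by rewrite /root !hornerE E subrr.
exists (c ^+ k) => //; apply: (mulfI c0).
by rewrite -exprM -exprS mulr1 mulnC -addn1 mulnC -qE expf_card.
Qed.

End Cubes.

(** * Counting syndromes *)

Section Numbers.
Local Open Scope ring_scope.
Variable F : finFieldType.
Hypothesis hq : (5 <= #|F|)%N.
Local Notation q := #|F|.
Local Notation pt := (option F).
Local Notation vec := (vec F).
Local Notation quad := (quad F).
Implicit Types (x y z : pt) (u : vec) (S : {set pt}) (s : quad).

Definition num (P : pred quad) : nat := (\sum_(s : quad) P s)%N.

Lemma num_card P : num P = #|[set s | P s]|.
Proof.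
by rewrite -sum1_card big_mkcond; apply: eq_bigr => s _; rewrite inE; case: ifP.
Qed.

Lemma eq_num P Q : P =1 Q -> num P = num Q.
Proof. by move=> E; apply: eq_bigr => s _; rewrite E. Qed.

Lemma num_cw0 : num (fun s => cw s == 0%N) = 1%N.
Proof.
rewrite num_card -(cards1 ((0,0,0,0) : quad)); apply: eq_card => s.
by rewrite !inE cw_eq0.
Qed.

(** Summing over all syndromes counts each of the [q ^ m] vectors supported in an m-set exactly
    once. *)
Lemma sum_Am (m : nat) : (\sum_(s : quad) Am s m = 'C(q.+1, m) * q ^ m)%N.
Proof.
rewrite /Am exchange_big /= -card_pt -card_draws -sum_nat_const.
rewrite [RHS](eq_bigl (fun S => #|S| == m)); last by move=> S; rewrite inE.
apply: eq_bigr => S /eqP <-; rewrite -card_supp_sub -sum1_card.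
rewrite (partition_big (@syn F) xpredT) //=; apply: eq_bigr => s _.
by rewrite -sum1_card; apply: eq_bigl => u; rewrite !inE andbC.
Qed.

Lemma num_cw1 : (num (fun s => cw s == 1%N) + q.+1 = q.+1 * q)%N.
Proof.
have := sum_Am 1; rewrite bin1 expn1 => <-.
rewrite (eq_bigr _ (fun s _ => Am1_cw hq s)) big_split -big_distrr /=.
by rewrite -/(num _) -/(num (fun s => cw s == 0%N)) num_cw0 muln1 addnC.
Qed.

Lemma num_cw2 :
  (2 * num (fun s => cw s == 2%N) + 2 * q * num (fun s => cw s == 1%N) + q.+1 * q =
   q.+1 * q * q ^ 2)%N.
Proof.
transitivity (2 * \sum_(s : quad) Am s 2)%N; last by rewrite sum_Am mulnA bin2_mul2.
have -> : (q.+1 * q = q.+1 * q * num (fun s => cw s == 0))%N by rewrite num_cw0 muln1.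
rewrite /num !big_distrr -!big_split /=.
by apply: eq_bigr => s _; rewrite Am2_cw //; ring.
Qed.

Lemma num_split (P : pred quad) :
  num P = (num (fun s => (cw s == 0%N) && P s) + num (fun s => (cw s == 1%N) && P s) +
   num (fun s => (cw s == 2%N) && P s) + num (fun s => (cw s == 3%N) && P s))%N.
Proof.
rewrite /num -!big_split; apply: eq_bigr => s _ /=.
by have := cw_le3 hq s; case: (cw s) => [|[|[|[|]]]] //; case: (P s).
Qed.

Lemma num_all : num xpredT = (q ^ 4)%N.
Proof. by rewrite num_card -card_quad -cardsT; apply: eq_card => s; rewrite !inE. Qed.

Lemma num_and (P Q : pred quad) : (forall s, P s -> Q s) -> num (fun s => P s && Q s) = num P.
Proof. by move=> H; apply: eq_num => s; have := H s; case: (P s) => //= ->. Qed.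

Lemma num_andF (P Q : pred quad) :
  (forall s, P s -> ~~ Q s) -> num (fun s => P s && Q s) = 0%N.
Proof.
by move=> H; apply: big1 => s _; have := H s; case: (P s) => //= /(_ isT) /negbTE ->.
Qed.

(** Each tangent is a plane in F^4: the tangency equations leave the first two entries of [s] free
    at a finite point and the last two at infinity. *)
Lemma sum_tg : (\sum_(s : quad) tg s = q.+1 * q ^ 2)%N.
Proof.
rewrite /tg exchange_big /= -card_pt -sum_nat_const; apply: eq_bigr => x _.
rewrite -/(num (fun s => sec s x x)) num_card -mulnn -card_prod.
case: x => [b|].
  pose f (p : F * F) : quad := (p.1, p.2, 2%:R * b * p.2 - b ^+ 2 * p.1,
     2%:R * b * (2%:R * b * p.2 - b ^+ 2 * p.1) - b ^+ 2 * p.2).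
  rewrite -cardsT -(card_imset _ (f := f)); last by move=> [a c] [d e] [-> ->].
  apply: eq_card => -[[[s0 s1] s2] s3]; rewrite inE /sec /=; apply/andP/imsetP.
    case=> /eqP Hu /eqP Hv; exists (s0, s1) => //; rewrite /f /=.
    have E2 : s2 = 2%:R * b * s1 - b ^+ 2 * s0.
      by apply/eqP; rewrite -subr_eq0; apply/eqP; rewrite -[RHS]Hv; ring.
    have E3 : s3 = 2%:R * b * s2 - b ^+ 2 * s1.
      by apply/eqP; rewrite -subr_eq0; apply/eqP; rewrite -[RHS]Hu; ring.
    by rewrite -E2 -E3.
  by case=> -[a c] _ [-> -> -> ->]; split; apply/eqP; ring.
pose f (p : F * F) : quad := (0, 0, p.1, p.2).
rewrite -cardsT -(card_imset _ (f := f)); last by move=> [a c] [d e] [-> ->].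
apply: eq_card => -[[[s0 s1] s2] s3]; rewrite inE /sec /=; apply/andP/imsetP.
  case=> /eqP Hu /eqP Hv; exists (s2, s3) => //; rewrite /f /=.
  have E1 : s1 = 0 by rewrite -Hu; ring.
  have E0 : s0 = 0 by rewrite -Hv; ring.
  by rewrite E0 E1.
by case=> -[a c] _ [-> -> -> ->]; split; apply/eqP; ring.
Qed.

Lemma tg0 s : cw s = 0%N -> tg s = q.+1.
Proof.
move/eqP; rewrite cw_eq0 // => /eqP ->; rewrite -card_pt -sum1_card.
by apply: eq_bigr => x _; rewrite (_ : sec _ _ _) //; apply/secP => z; rewrite pol0.
Qed.

Lemma rt0 s : cw s = 0%N -> rt s = q.+1.
Proof.
move/eqP; rewrite cw_eq0 // => /eqP ->; rewrite -card_pt -sum1_card.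
by apply: eq_bigr => x _; rewrite /osc pol0 eqxx.
Qed.

(** The sum [sum_tg] is split by coset weight: t is q + 1 at zero, 1 on weight 1, 0 on weight 2 and
    at most 1 on weight 3. *)
Lemma num_tg :
  (num (fun s => (cw s == 3%N) && (tg s == 1%N)) + num (fun s => cw s == 1%N) + q.+1 =
   q.+1 * q ^ 2)%N.
Proof.
have E : (q.+1 = q.+1 * num (fun s => cw s == 0))%N by rewrite num_cw0 muln1.
rewrite -sum_tg {1}E /num big_distrr -!big_split /=.
apply: eq_bigr => s _; have := cw_le3 hq s.
case c: (cw s) => [|[|[|[|k]]]] // _.
- by rewrite tg0 // muln1.
- by rewrite tg_cw1 // muln0.
- by rewrite tg_cw2 // muln0.
have : (tg s <= 1)%N by apply: tg_le1; rewrite ?c.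
by case: (tg s) => [|[|k]] //= _; rewrite muln0.
Qed.

(** * Moments of the number of osculating planes when 3 is invertible *)

Hypothesis n3 : 3%:R != 0 :> F.

(** The coefficients of the cubic T_s(z, z, z) are the entries of [s] up to sign and the binomial
    factors 1, 3, 3, 1. *)
Lemma osc_pairing u s : \sum_z u z * pol s z z z =
  s.2 * (syn u).1.1.1 - 3%:R * s.1.2 * (syn u).1.1.2 +
  3%:R * s.1.1.2 * (syn u).1.2 - s.1.1.1 * (syn u).2.
Proof.
rewrite /syn /syndrome /= !mulr_sumr -!sumrN -!big_split /=; apply: eq_bigr => z _.
by case: s => [[[s0 s1] s2] s3]; rewrite !pcolE /pol /polU /polV /=; ring.
Qed.

Definition ev S s : vec := [ffun z => if z \in S then pol s z z z else 0].

(** Vectors supported in S with the four unit syndromes read off the entries of [s], the middle two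
    up to the factor 3. *)
Lemma ev_inj S : #|S| = 4%N -> injective (ev S).
Proof.
move=> S4 s t E.
have H u : supp u \subset S -> \sum_z u z * pol s z z z = \sum_z u z * pol t z z z.
  move=> uS; apply: eq_bigr => z _; have := congr1 (fun f : vec => f z) E; rewrite !ffunE.
  by case: ifP => [_ -> //|zS _]; rewrite (suppP uS) ?zS // !mul0r.
have [u0 /H H0 E0] := syn_surj4 (1,0,0,0) S4.
have [u1 /H H1 E1] := syn_surj4 (0,1,0,0) S4.
have [u2 /H H2 E2] := syn_surj4 (0,0,1,0) S4.
have [u3 /H H3 E3] := syn_surj4 (0,0,0,1) S4.
move: H0 H1 H2 H3; rewrite !osc_pairing E0 E1 E2 E3 /=.
case: s {E H} => [[[s0 s1] s2] s3]; case: t => [[[t0 t1] t2] t3] /=.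
rewrite !(mulr0, mulr1, subr0, addr0, add0r, sub0r, oppr0).
by move=> -> /oppr_inj /(mulfI n3) -> /(mulfI n3) -> /oppr_inj ->.
Qed.

(* When 3 is invertible, evaluation of T_s(z, z, z) at four points is bijective in [s]. *)
Lemma num_osc S : (#|S| <= 4)%N ->
  num (fun s => S \subset [set z | osc s z]) = (q ^ (4 - #|S|))%N.
Proof.
move=> cS; have [A SA A4] : exists2 A : {set pt}, S \subset A & #|A| = 4%N.
  have : (0 < #|[set A : {set pt} | #|A| == 4%N & S \subset A]|)%N.
    by rewrite card_supersets cS bin_gt0 card_pt; lia.
  by case/card_gt0P => A; rewrite inE => /andP[/eqP]; exists A.
have -> : (4 - #|S|)%N = #|A :\: S| by rewrite cardsD (setIidPr SA) A4.
rewrite -card_supp_sub num_card -(card_imset _ (ev_inj A4)).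
have im : ev A @: [set: quad] = [set u | supp u \subset A].
  apply/eqP; rewrite eqEcard card_supp_sub A4 (card_imset _ (ev_inj A4)).
  rewrite cardsT card_quad leqnn andbT.
  apply/subsetP => _ /imsetP[s _ ->]; rewrite inE; apply/subsetP => z.
  by rewrite inE ffunE; case: ifP => //; rewrite eqxx.
apply: eq_card => u; rewrite inE; apply/imsetP/subsetP => [[s + ->] z|H].
  rewrite inE => /subsetP Ss; rewrite !inE ffunE; case: ifP; rewrite ?eqxx // => zA.
  by rewrite andbT; apply: contra => /Ss; rewrite inE.
have : u \in ev A @: [set: quad].
  by rewrite im inE; apply/subsetP => z /H; rewrite inE => /andP[].
case/imsetP => s _ us; exists s => //; rewrite inE; apply/subsetP => z zS; rewrite inE.
apply: contraT => ns; have : z \in supp u by rewrite us inE ffunE (subsetP SA _ zS).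
by move/H; rewrite inE zS.
Qed.

(** The binomial coefficient counts k-sets of osculation points of [s]; the sums over [s] and over
    k-sets are exchanged. *)
Lemma sum_bin_rt (k : nat) : (k <= 4)%N ->
  (\sum_(s : quad) 'C(rt s, k) = 'C(q.+1, k) * q ^ (4 - k))%N.
Proof.
move=> k4.
transitivity (\sum_(S : {set pt} | #|S| == k) num (fun s => S \subset [set z | osc s z]))%N.
  rewrite exchange_big; apply: eq_bigr => s _ /=.
  rewrite rt_card -cards_draws -sum1_card [LHS]big_mkcond [RHS]big_mkcond /=.
  by apply: eq_bigr => S _; rewrite inE andbC; case: eqP => //=; case: ifP.
rewrite -card_pt -card_draws -sum_nat_const.
rewrite [RHS](eq_bigl (fun S => #|S| == k)); last by move=> S; rewrite inE.
by apply: eq_bigr => S /eqP cS; rewrite num_osc cS.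
Qed.

(** Four zeros of T_s(z, z, z) would force [s] to be zero by [ev_inj]. *)
Lemma rt_le3 s : cw s != 0%N -> (rt s <= 3)%N.
Proof.
apply: contraR; rewrite -ltnNge rt_card => /exists_subset_card[A AS A4].
rewrite cw_eq0 //; apply/eqP; apply: (ev_inj A4); apply/ffunP => z; rewrite !ffunE.
by case: ifP => // /(subsetP AS); rewrite inE => /eqP ->; rewrite pol0.
Qed.

Definition nrt (k : nat) := num (fun s => (cw s != 0%N) && (rt s == k)).

Lemma sum_rt (f : nat -> nat) :
  (\sum_(s : quad) f (rt s) =
   f q.+1 + f 0 * nrt 0 + f 1 * nrt 1 + f 2 * nrt 2 + f 3 * nrt 3)%N.
Proof.
have -> : (f q.+1 = f q.+1 * num (fun s => cw s == 0))%N by rewrite num_cw0 muln1.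
rewrite /nrt /num !big_distrr -!big_split /=; apply: eq_bigr => s _.
have [c0|c0] := eqVneq (cw s) 0%N; first by rewrite rt0 // !muln0 !addn0 muln1.
have := rt_le3 c0; case: (rt s) => [|[|[|[|]]]] // _;
  by rewrite /= !muln0 !muln1 !addn0 ?add0n.
Qed.

(** The binomial moments of orders 3, 2, 1, 0 form a triangular system for [nrt 3], [nrt 2],
    [nrt 1], [nrt 0], solved in this order; the zero syndrome contributes the term with r = q +
    1. *)
Lemma nrt3 : (6 * nrt 3 = q.+1 * q * q.-1 * q.-1)%N.
Proof.
have := sum_bin_rt (isT : 3 <= 4)%N; rewrite (sum_rt (fun r => 'C(r, 3))).
have := bin3_mul6 q; rewrite (_ : 'C(0, 3) = 0)%N // (_ : 'C(1, 3) = 0)%N //.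
rewrite (_ : 'C(2, 3) = 0)%N // (_ : 'C(3, 3) = 1)%N //.
by case: (q) hq => // p; rewrite (_ : 4 - 3 = 1)%N // expn1 /=; nia.
Qed.

Lemma nrt2 : (nrt 2 = q.+1 * q * q.-1)%N.
Proof.
have := sum_bin_rt (isT : 2 <= 4)%N; rewrite (sum_rt (fun r => 'C(r, 2))).
have := bin2_mul2 q; have := nrt3.
rewrite (_ : 'C(0, 2) = 0)%N // (_ : 'C(1, 2) = 0)%N //.
rewrite (_ : 'C(2, 2) = 1)%N // (_ : 'C(3, 2) = 3)%N //.
by case: (q) hq => // p; rewrite (_ : 4 - 2 = 2)%N // /=; nia.
Qed.

Lemma nrt1 : (2 * nrt 1 = q.+1 * q.-1 * (q * q.-1 + 2))%N.
Proof.
have := sum_bin_rt (isT : 1 <= 4)%N; rewrite (sum_rt (fun r => 'C(r, 1))) !bin1.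
have := nrt2; have := nrt3.
by case: (q) hq => // p; rewrite (_ : 4 - 1 = 3)%N // /=; nia.
Qed.

Lemma nrt0 : (3 * nrt 0 = q.+1 * q * q.-1 * q.-1)%N.
Proof.
have := sum_bin_rt (isT : 0 <= 4)%N; rewrite (sum_rt (fun r => 'C(r, 0))) !bin0.
have := nrt2; have := nrt3; have := nrt1.
by case: (q) hq => // p; rewrite (_ : 4 - 0 = 4)%N // /=; nia.
Qed.

Lemma nrt_split (k : nat) :
  nrt k = (num (fun s => (cw s == 1%N) && (rt s == k)) +
           num (fun s => (cw s == 2%N) && (rt s == k)) +
           num (fun s => (cw s == 3%N) && (rt s == k)))%N.
Proof.
rewrite /nrt /num -!big_split; apply: eq_bigr => s _ /=.
by have := cw_le3 hq s; case: (cw s) => [|[|[|[|]]]] //; case: (rt s == k).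
Qed.

End Numbers.

(** * Weight distributions within a coset weight *)

Section Distributions.
Variable F : finFieldType.
Hypothesis hq : (5 <= #|F|)%N.
Local Notation q := #|F|.
Local Notation pt := (option F).
Local Notation vec := (vec F).
Local Notation quad := (quad F).
Implicit Types (x y z : pt) (u : vec) (S : {set pt}) (s : quad).
Local Open Scope ring_scope.
Local Open Scope nat_scope.

Lemma num_gt0 (P : pred quad) : 0 < num P -> exists s, P s.
Proof. by rewrite num_card => /card_gt0P[s]; rewrite inE; exists s. Qed.

Lemma num_eq0 (P : pred quad) s : num P = 0 -> P s = false.
Proof. by rewrite num_card => /cards0_eq/setP/(_ s); rewrite !inE. Qed.

(** Here [k] is an invariant that separates the values of A_3 within coset weight [j]. Each nonempty
    level of [k] is then the class of a single weight distribution, taken from any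
    representative. *)
Lemma class_dist j (k : quad -> nat) a :
  (forall s s', cw s = j -> cw s' = j -> (Am s 3 == Am s' 3) = (k s == k s')) ->
  0 < num (fun s => (cw s == j) && (k s == a)) ->
  exists2 d, ncos F j d = num (fun s => (cw s == j) && (k s == a)) &
    forall s, cw s = j -> (wdist (fib s) == d) = (k s == a).
Proof.
move=> kP /num_gt0[s1 /andP[/eqP c1 /eqP k1]].
have dP s : cw s = j -> (wdist (fib s) == wdist (fib s1)) = (k s == a).
  move=> cs; rewrite -k1 -kP //; apply/eqP/eqP; apply wdist_class => //; by rewrite cs c1.
exists (wdist (fib s1)) => //; rewrite ncosE // -num_card; apply: eq_num => s /=.
by case: eqP => //= cs; rewrite dP.
Qed.

Lemma dist_neq j (k : quad -> nat) a b d e : a != b ->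
  0 < num (fun s => (cw s == j) && (k s == a)) ->
  (forall s, cw s = j -> (wdist (fib s) == d) = (k s == a)) ->
  (forall s, cw s = j -> (wdist (fib s) == e) = (k s == b)) -> d != e.
Proof.
move=> ab /num_gt0[s /andP[/eqP cs ks]] dP eP.
have := eP s cs; have := dP s cs; rewrite ks (eqP ks) (negbTE ab) => /eqP -> ->.
by [].
Qed.

(** On weight 2, A_2 = 1 and t = 0, so 6 A_3 - 2 r is constant. *)
Lemma Am3_cw2 s s' : cw s = 2 -> cw s' = 2 -> (Am s 3 == Am s' 3) = (rt s == rt s').
Proof.
move=> c c'; have := triple_count hq s; have := triple_count hq s'.
have := Am2_cw hq s; have := Am2_cw hq s'; rewrite c c' /= !tg_cw2 //.
by move=> E E' T T'; apply/eqP/eqP; nia.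
Qed.

Lemma rt_cw2_1 s : q %% 3 != 1 -> cw s = 2 -> rt s = 1.
Proof.
move=> q1 /(rt_cw2 hq)[g _ ->]; have inj := cube_inj q1.
have /codomP[c gc] := injF_onto inj g.
rewrite (_ : [set _ | _] = [set c]) ?cards1 //.
by apply/setP => d; rewrite !inE gc (inj_eq inj).
Qed.

Lemma rt_cw2_03 s : q %% 3 = 1 -> cw s = 2 -> rt s = 0 \/ rt s = 3.
Proof.
move=> q1 c2.
have n3 : (3%:R != 0 :> F)%R by rewrite three_eq0 q1.
have le3 : rt s <= 3 by apply: rt_le3; rewrite ?c2.
have [g g0 E] := rt_cw2 hq c2; have [o o3 o1] := cube_root1 q1.
have [|[c]] := set_0Vmem [set c : F | (c ^+ 3 == g)%R].
  by rewrite E => ->; rewrite cards0; left.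
rewrite inE => /eqP cg; right; apply/eqP; rewrite eqn_leq le3 E /=.
have c0 : (c != 0)%R by apply: contraNneq g0 => c0; rewrite -cg c0 expr0n.
have o0 : (o != 0)%R by apply: contra_eq_neq o3 => ->; rewrite expr0n /= eq_sym oner_eq0.
(* One cube root c of g yields three, by multiplication with the cube roots of unity. *)
apply: leq_trans (subset_leq_card (_ : [set c; o * c; o ^+ 2 * c]%R \subset _)); last first.
  apply/subsetP => d; rewrite !inE -orbA => /or3P[] /eqP ->; rewrite ?exprMn ?cg ?o3 ?mul1r //.
have h1 : (c != o * c)%R by rewrite -{1}[c]mul1r (inj_eq (mulIf c0)) eq_sym.
have h2 : (c != o ^+ 2 * c)%R.
  rewrite -{1}[c]mul1r (inj_eq (mulIf c0)); apply: contraNneq o1 => oE.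
  by rewrite -o3 exprS - oE mulr1.
have h3 : (o * c != o ^+ 2 * c)%R.
  rewrite (inj_eq (mulIf c0)); apply: contraNneq o1 => oE.
  by apply/eqP/(mulfI o0); rewrite -expr2 mulr1.
by rewrite -setUA cardsU1 cards2 !inE negb_or h1 h2 h3.
Qed.

Definition nwt j : nat := num (fun s => cw s == j).
Definition nwr j k : nat := num (fun s => (cw s == j) && (rt s == k)).

Lemma nwt1 : nwt 1 = q.+1 * q.-1.
Proof. by have := num_cw1 hq; rewrite /nwt; case: (q) hq => // p; nia. Qed.

Lemma nwt2 : 2 * nwt 2 = q.+1 * q * q.-1 * q.-1.
Proof. by have := num_cw2 hq; rewrite -/(nwt 1) -/(nwt 2) nwt1; case: (q) hq => // p; nia. Qed.

Lemma num_tgE : num (fun s => (cw s == 3) && (tg s == 1)) = q.+1 * q * q.-1.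
Proof. by have := num_tg hq; rewrite -/(nwt 1) nwt1; case: (q) hq => // p; nia. Qed.

Lemma nwr1 k : nwr 1 k = (k == 1) * nwt 1.
Proof.
rewrite /nwr /nwt; case: (k =P 1) => [->|/eqP k1].
  by rewrite mul1n num_and // => s /eqP c1; rewrite rt_cw1.
by rewrite num_andF // => s /eqP c1; rewrite rt_cw1 // eq_sym.
Qed.

(** * Weight-3 cosets in characteristic different from 3 *)

Section CharNot3.
Hypothesis n3 : (3%:R != 0 :> F)%R.
Hypothesis rt2 : forall s, cw s = 2 -> rt s != 2.

Lemma nrt_nwr k : nrt F k = (k == 1) * nwt 1 + nwr 2 k + nwr 3 k.
Proof. by rewrite nrt_split // -/(nwr 1 k) nwr1. Qed.

(** By [tg_rt], t = 1 implies r = 2. Since r = 2 does not occur on weights 1 and 2, [nrt2] counts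
    the weight-3 syndromes with r = 2, and it equals the number with t = 1, so the two sets
    agree. *)
Lemma tg_rt2 s : cw s = 3 -> tg s = (rt s == 2).
Proof.
have H : num (fun s => (cw s == 3) && ((rt s == 2) && (tg s != 1))) = 0.
  have := nrt_nwr 2; rewrite nrt2 // [nwr 2 2]num_andF; last by move=> t /eqP /rt2.
  rewrite -num_tgE.
  suff -> : nwr 3 2 = num (fun s => (cw s == 3) && (tg s == 1)) +
      num (fun s => (cw s == 3) && ((rt s == 2) && (tg s != 1))) by lia.
  rewrite /nwr /num -big_split; apply: eq_bigr => t _ /=; case: eqP => // c3.
  have [E|E] /= := eqVneq (tg t) 1; last by rewrite andbT add0n.
  by rewrite (tg_rt hq n3 _ E) ?c3.
move=> c3; have := num_eq0 s H; rewrite c3 /=.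
have : tg s <= 1 by apply: tg_le1; rewrite ?c3.
have := @tg_rt _ hq s n3; rewrite c3.
case: (tg s) => [|[|t]] //; first by case: eqP.
by move=> /(_ isT erefl) ->.
Qed.

(** Here 6 A_3 is a constant plus 2 r - 2 q t with t = 1 only for r = 2. For r = 0, 1, 2, 3 the
    variable part is 0, 2, 4 - 2 q, 6, and these differ for q >= 5. *)
Lemma Am3_cw3 s s' : cw s = 3 -> cw s' = 3 -> (Am s 3 == Am s' 3) = (rt s == rt s').
Proof.
move=> c c'; have := triple_count hq s; have := triple_count hq s'.
have := Am2_cw hq s; have := Am2_cw hq s'; rewrite c c' /= !tg_rt2 //.
have := @rt_le3 _ hq n3 s; have := @rt_le3 _ hq n3 s'; rewrite c c' => /(_ isT) r' /(_ isT) r.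
move=> E E'; have {E} -> : Am s' 2 = 0 by lia.
have {E'} -> : Am s 2 = 0 by lia.
by move: r r'; case: (rt s) => [|[|[|[|]]]] //; case: (rt s') => [|[|[|[|]]]] //= _ _ T T';
  move: T T' hq; move: (q) (Am s 3) (Am s' 3) => k a b T T' hk; apply/eqP/eqP; lia.
Qed.

End CharNot3.

(** * Weight-3 cosets in characteristic 3 *)

Section Char3.
Hypothesis e3 : (3%:R = 0 :> F)%R.

(* The common line of all osculating planes in characteristic 3. *)
Definition axis s := (s.1.1.1 == 0%R) && (s.2 == 0%R).

Lemma q_mod3 : q %% 3 = 0.
Proof. by apply/eqP; rewrite -three_eq0 e3. Qed.

(** With [a] and [b] the cube roots of the last and first entries of [s], injectivity of cubing
    turns osculation at z into a linear equation in z. *)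
Lemma rt_char3 s : rt s = (q * axis s).+1.
Proof.
have inj : injective (fun c : F => c ^+ 3)%R by apply: cube_inj; rewrite q_mod3.
have /codomP[a Ea] := injF_onto inj s.2.
have /codomP[b Eb] := injF_onto inj s.1.1.1.
rewrite /axis Ea Eb !expf_eq0 /= andbC -sum_lin; apply: eq_bigr => z _; rewrite /osc.
have -> : (pol s z z z = (pa z * a) ^+ 3 - (pb z * b) ^+ 3)%R.
  case: s Ea Eb => [[[s0 s1] s2] s3] /= -> ->; rewrite /pol /polU /polV.
  transitivity ((pa z * a) ^+ 3 - (pb z * b) ^+ 3 +
    3%:R * (pa z * pb z ^+ 2 * s1 - pa z ^+ 2 * pb z * s2))%R; first by ring.
  by rewrite e3 mul0r addr0.
by rewrite !subr_eq0 (inj_eq inj).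
Qed.

(** On the axis r = q + 1, whereas r = 1 on weights 1 and 2. *)
Lemma axis_cw3 s : axis s -> cw s != 0 -> (cw s == 3) && (tg s == 1).
Proof.
move=> ax c0; have := rt_char3 s; rewrite ax muln1 => E.
have c3 : cw s = 3.
  have := cw_le3 hq s; case c: (cw s) c0 => [|[|[|[|]]]] // _.
    by have := rt_cw1 hq c; lia.
  by have := rt_cw2_1 _ c; rewrite q_mod3 => /(_ isT); lia.
rewrite c3 /= eqn_leq tg_le1 ?c3 //= tg_card; apply/card_gt0P.
case: s ax {E c0 c3} => [[[s0 s1] s2] s3] /andP[/= /eqP -> /eqP ->].
(* Modulo 3 both tangency conditions are multiples of this linear equation for the point of
   contact. *)
have [x xP] : exists x, (pa x * s2 + pb x * s1 = 0)%R.
  by exists (linroot s2 (- s1)%R); rewrite -(linrootP s2 (- s1)%R); ring.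
exists x; rewrite inE /sec /polU /polV; apply/andP; split; apply/eqP.
  transitivity (pb x * (pa x * s2 + pb x * s1) - 3%:R * (pa x * pb x * s2))%R; first by ring.
  by rewrite xP e3 mulr0 mul0r subr0.
transitivity (pa x * (pa x * s2 + pb x * s1) - 3%:R * (pa x * pb x * s1))%R; first by ring.
by rewrite xP e3 mulr0 mul0r subr0.
Qed.

Lemma num_axis : num axis = q ^ 2.
Proof.
rewrite num_card -mulnn -card_prod -cardsT.
rewrite -(card_imset _ (f := fun p : F * F => (0%R, p.1, p.2, 0%R) : quad)); last first.
  by move=> [a c] [d e] [-> ->].
apply: eq_card => -[[[s0 s1] s2] s3]; rewrite inE; apply/andP/imsetP => /=.
  by case=> /eqP -> /eqP ->; exists (s1, s2).
by case=> -[a b] _ [-> _ _ ->].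
Qed.

(** In [triple_count] a tangent contributes 2 q on one side and the axis 2 q on the other. Axis
    points thus have the same A_3 as weight-3 points on no tangent, and only tangent points off the
    axis stand apart. *)
Definition tan3 s : nat := (tg s == 1) && ~~ axis s.

(** The q^2 - 1 nonzero axis points are removed from the weight-3 tangent points. *)
Lemma num_tan3 : num (fun s => (cw s == 3) && (tan3 s == 1)) = (q ^ 2 - 1) * (q - 1).
Proof.
suff : num (fun s => (cw s == 3) && (tan3 s == 1)) + num axis =
    num (fun s => (cw s == 3) && (tg s == 1)) + num (fun s => cw s == 0).
  rewrite num_axis num_tgE num_cw0 //; case: (q) hq => // p; nia.
rewrite /num -!big_split; apply: eq_bigr => s _ /=; rewrite /tan3.
have := @axis_cw3 s; case: (boolP (axis s)) => ax; last first.
  rewrite andbT addn0; case: eqP => [c0 _|_ _] /=; last first.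
    by case: (cw s == 3); case: (tg s == 1).
  move: ax; move/eqP: c0; rewrite cw_eq0 // => /eqP ->; rewrite /axis /=.
  by rewrite !eqxx.
by rewrite andbF /=; case: eqP => [-> _|_ /(_ isT isT) ->] //; case: (cw s == 3).
Qed.

Lemma Am3_char3 s s' : cw s = 3 -> cw s' = 3 -> (Am s 3 == Am s' 3) = (tan3 s == tan3 s').
Proof.
have H t : cw t = 3 -> [/\ Am t 2 = 0, tg t <= 1 & axis t -> tg t = 1].
  move=> c; split; first by have := Am2_cw hq t; rewrite c; lia.
    by apply: tg_le1; rewrite ?c.
  by move/axis_cw3; rewrite c => /(_ isT) /eqP.
move=> /H[A t1 ax] /H[A' t1' ax'].
have := triple_count hq s; have := triple_count hq s'; rewrite A A' !rt_char3 /tan3.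
move: hq t1 t1' ax ax'; move: (q) (Am s 3) (Am s' 3) (tg s) (tg s') (axis s) (axis s').
move=> k a b [|[|?]] [|[|?]] [] [] // hk _ _ ax ax' T T';
  try (by have := ax isT); try (by have := ax' isT); apply/eqP/eqP => //; lia.
Qed.

End Char3.
End Distributions.

(** * Sizes of the classes for each residue of q modulo 3 *)

Section Census.
Variable F : finFieldType.
Hypothesis hq : 5 <= #|F|.
Local Notation q := #|F|.
Local Notation quad := (quad F).
Local Notation nwr := (nwr F).
Local Notation nwt := (nwt F).
Implicit Type s : quad.

(** Weight-2 syndromes have r = 0 or r = 3, and their number equals [nrt 0 + nrt 3]. They exhaust
    these values, which leaves r = 1, 2 for weight 3. *)
Lemma census_mod1 : q %% 3 = 1 ->
  [/\ 3 * nwr 2 0 = q.+1 * q * q.-1 * q.-1, 6 * nwr 2 3 = q.+1 * q * q.-1 * q.-1,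
      nwr 3 2 = q.+1 * q * q.-1, 2 * nwr 3 1 = q.+1 * q * q.-1 * q.-1 &
      forall s, cw s = 3 -> rt s = 2 \/ rt s = 1].
Proof.
move=> q1; have n3 : (3%:R != 0 :> F)%R by rewrite three_eq0 q1.
have r03 s : cw s = 2 -> rt s = 0 \/ rt s = 3 by apply: rt_cw2_03.
have Z k : k != 0 -> k != 3 -> nwr 2 k = 0.
  by move=> k0 k3; apply: num_andF => s /eqP /r03[] ->; rewrite eq_sym.
have W2 : nwt 2 = nwr 2 0 + nwr 2 3.
  rewrite /nwt /nwr /num -big_split; apply: eq_bigr => s _ /=.
  by case: eqP => // /r03[] ->.
have := nwt1 hq; have := nwt2 hq.
have := nrt0 hq n3; have := nrt1 hq n3; have := nrt2 hq n3; have := nrt3 hq n3.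
rewrite !nrt_nwr // (Z 1) // (Z 2) // W2 /= => N3 N2 N1 N0 E2 E1; rewrite E1 in N1.
have v0 : nwr 3 0 = 0 by lia.
have v3 : nwr 3 3 = 0 by lia.
split; try lia.
move=> s c3; have := num_eq0 s v0; have := num_eq0 s v3; rewrite c3 /=.
have := @rt_le3 _ hq n3 s; rewrite c3 => /(_ isT).
by case: (rt s) => [|[|[|[|]]]] //; [right|left].
Qed.

(** Weights 1 and 2 have r = 1 throughout and together number [nrt 1], so r = 1 does not occur on
    weight 3. *)
Lemma census_mod2 : q %% 3 = 2 ->
  [/\ nwr 3 2 = q.+1 * q * q.-1, 3 * nwr 3 0 = q.+1 * q * q.-1 * q.-1,
      6 * nwr 3 3 = q.+1 * q * q.-1 * q.-1 &
      forall s, cw s = 3 -> [\/ rt s = 2, rt s = 0 | rt s = 3]].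
Proof.
move=> q2; have n3 : (3%:R != 0 :> F)%R by rewrite three_eq0 q2.
have r1 s : cw s = 2 -> rt s = 1 by apply: rt_cw2_1; rewrite ?q2.
have Z k : k != 1 -> nwr 2 k = 0.
  by move=> k1; apply: num_andF => s /eqP /r1 ->; rewrite eq_sym.
have W2 : nwr 2 1 = nwt 2 by apply: num_and => s /eqP /r1 ->.
have := nwt1 hq; have := nwt2 hq.
have := nrt0 hq n3; have := nrt1 hq n3; have := nrt2 hq n3; have := nrt3 hq n3.
rewrite !nrt_nwr // (Z 0) // (Z 2) // (Z 3) // W2 /= => N3 N2 N1 N0 E2 E1; rewrite E1 in N1.
have v1 : nwr 3 1 = 0 by lia.
split; try lia.
move=> s c3; have := num_eq0 s v1; rewrite c3 /=.
have := @rt_le3 _ hq n3 s; rewrite c3 => /(_ isT).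
by case: (rt s) => [|[|[|[|]]]] // _ _; [constructor 2|constructor 1|constructor 3].
Qed.

(** The count is what remains of the q^4 syndromes after all other classes are removed. *)
Lemma census_mod0 : q %% 3 = 0 ->
  2 * num (fun s => (cw s == 3) && (tan3 s == 0)) = q.+1 * (q * q.-1 + 2) * q.-1.
Proof.
move/eqP; rewrite -three_eq0 => /eqP e3.
have W3 : nwt 3 = num (fun s => (cw s == 3) && (tan3 s == 1)) +
    num (fun s => (cw s == 3) && (tan3 s == 0)).
  rewrite /nwt /num -big_split; apply: eq_bigr => s _ /=.
  by rewrite /tan3; case: (cw s == 3) => //; case: (tg s == 1) => //; case: (axis s).
have E : q ^ 4 = 1 + nwt 1 + nwt 2 + nwt 3.
  rewrite -num_all num_split // -(num_cw0 hq).
  by do ![congr addn]; apply: eq_num => s; rewrite andbT.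
have X : (q ^ 2 - 1) * (q - 1) = q.+1 * q.-1 * q.-1 by case: (q) hq => // p _; nia.
move: E; rewrite W3 num_tan3 // X nwt1 //; have := nwt2 hq.
by move: (num _) (nwt 2) => A B; case: (q) hq => // p _; nia.
Qed.

End Census.

Theorem theorem3p6 (F : finFieldType) (hq : 5 <= #|F|) :
  let q := #|F| in
  (* (i) *)
  (forall X Y, X \in cosets F -> Y \in cosets F ->
     coset_wt X = 1 -> coset_wt Y = 1 -> wdist X = wdist Y)
  /\
  (* (ii) *)
  (q %% 3 != 1 ->
     forall X Y, X \in cosets F -> Y \in cosets F ->
     coset_wt X = 2 -> coset_wt Y = 2 -> wdist X = wdist Y)
  /\
  (q %% 3 = 1 ->
     exists d1 d2 : seq nat, d1 != d2 /\
       (forall X, X \in cosets F -> coset_wt X = 2 ->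
          wdist X = d1 \/ wdist X = d2) /\
       3 * ncos F 2 d1 = (q ^ 3 - q) * (q - 1) /\
       6 * ncos F 2 d2 = (q ^ 3 - q) * (q - 1))
  /\
  (* (iii) *)
  (q %% 3 = 1 ->
     exists d1 d2 : seq nat, d1 != d2 /\
       (forall X, X \in cosets F -> coset_wt X = 3 ->
          wdist X = d1 \/ wdist X = d2) /\
       ncos F 3 d1 = (q ^ 2 + q) * (q - 1) /\
       2 * ncos F 3 d2 = (q ^ 3 - q) * (q - 1))
  /\
  (q %% 3 = 2 ->
     exists d1 d2 d3 : seq nat, [/\ d1 != d2, d1 != d3 & d2 != d3] /\
       (forall X, X \in cosets F -> coset_wt X = 3 ->
          [\/ wdist X = d1, wdist X = d2 | wdist X = d3]) /\
       ncos F 3 d1 = (q ^ 2 + q) * (q - 1) /\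
       3 * ncos F 3 d2 = (q ^ 3 - q) * (q - 1) /\
       6 * ncos F 3 d3 = (q ^ 3 - q) * (q - 1))
  /\
  (q %% 3 = 0 ->
     exists d1 d2 : seq nat, d1 != d2 /\
       (forall X, X \in cosets F -> coset_wt X = 3 ->
          wdist X = d1 \/ wdist X = d2) /\
       ncos F 3 d1 = (q ^ 2 - 1) * (q - 1) /\
       2 * ncos F 3 d2 = (q + 1) * (q ^ 2 - q + 2) * (q - 1)).
Proof.
move=> q.
have X3 : (q ^ 3 - q) * (q - 1) = q.+1 * q * q.-1 * q.-1.
  by rewrite /q; case: (#|F|) hq => // p _; nia.
have X2 : (q ^ 2 + q) * (q - 1) = q.+1 * q * q.-1.
  by rewrite /q; case: (#|F|) hq => // p _; nia.
have X3_gt0 : 0 < q.+1 * q * q.-1 * q.-1 by rewrite !muln_gt0 /= /q; lia.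
have X2_gt0 : 0 < q.+1 * q * q.-1 by rewrite !muln_gt0 /= /q; lia.
split; [|split; [|split; [|split; [|split]]]].
(* On weight 1, A_2 = q and r = t = 1, so [triple_count] fixes A_3. *)
- move=> X Y /(cosetsP hq)[s ->] /(cosetsP hq)[s' ->] c c'.
  apply/(wdist_class hq); first by rewrite /cw c c'.
  have A2 (t : quad F) : cw t = 1 -> Am t 2 = #|F|.
    by move=> ct; have := Am2_cw hq t; rewrite ct; lia.
  have := triple_count hq s; have := triple_count hq s'.
  rewrite !rt_cw1 // !tg_cw1 // !A2 // => <- /addIn/eqP.
  by rewrite eqn_pmul2l // => /eqP.
- move=> q1 X Y /(cosetsP hq)[s ->] /(cosetsP hq)[s' ->] c c'.
  apply/(wdist_class hq); first by rewrite /cw c c'.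
  by apply/eqP; rewrite Am3_cw2 // !rt_cw2_1.
(* The two distributions belong to r = 0 and r = 3. *)
- move=> q1; have [m0 m3 _ _ _] := census_mod1 hq q1; rewrite -/q in m0 m3.
  have p0 : 0 < nwr F 2 0 by lia.
  have p3 : 0 < nwr F 2 3 by lia.
  have [d1 n1 d1P] := class_dist hq (@Am3_cw2 _ hq) p0.
  have [d2 n2 d2P] := class_dist hq (@Am3_cw2 _ hq) p3.
  exists d1, d2; split; first exact: dist_neq p0 d1P d2P.
  split; last by rewrite n1 n2 X3.
  move=> X /(cosetsP hq)[s ->] c.
  by case: (rt_cw2_03 hq q1 c) => r; [left|right]; apply/eqP; rewrite ?d1P ?d2P ?r.
(* Here [d1] belongs to r = 2, the points on tangents, and [d2] to r = 1. *)
- move=> q1; have [_ _ m2 m1 rP] := census_mod1 hq q1; rewrite -/q in m1 m2.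
  have n3 : (3%:R != 0 :> F)%R by rewrite three_eq0 -/q q1.
  have r2 (s : quad F) : cw s = 2 -> rt s != 2 by move/(rt_cw2_03 hq q1) => [] ->.
  have p2 : 0 < nwr F 3 2 by lia.
  have p1 : 0 < nwr F 3 1 by lia.
  have [d1 n1 d1P] := class_dist hq (Am3_cw3 hq n3 r2) p2.
  have [d2 n2 d2P] := class_dist hq (Am3_cw3 hq n3 r2) p1.
  exists d1, d2; split; first exact: dist_neq p2 d1P d2P.
  split; last by rewrite n1 n2 X3 X2.
  move=> X /(cosetsP hq)[s ->] c.
  by case: (rP s c) => r; [left|right]; apply/eqP; rewrite ?d1P ?d2P ?r.
(* The distributions [d1], [d2], [d3] belong to r = 2, 0, 3. *)
- move=> q2; have [m2 m0 m3 rP] := census_mod2 hq q2; rewrite -/q in m2 m0 m3.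
  have n3 : (3%:R != 0 :> F)%R by rewrite three_eq0 -/q q2.
  have r2 (s : quad F) : cw s = 2 -> rt s != 2.
    by move=> c; rewrite rt_cw2_1 // -/q q2.
  have p2 : 0 < nwr F 3 2 by lia.
  have p0 : 0 < nwr F 3 0 by lia.
  have p3 : 0 < nwr F 3 3 by lia.
  have [d1 n1 d1P] := class_dist hq (Am3_cw3 hq n3 r2) p2.
  have [d2 n2 d2P] := class_dist hq (Am3_cw3 hq n3 r2) p0.
  have [d3 n3' d3P] := class_dist hq (Am3_cw3 hq n3 r2) p3.
  exists d1, d2, d3; split.
    by split; [exact: dist_neq p2 d1P d2P|exact: dist_neq p2 d1P d3P|
               exact: dist_neq p0 d2P d3P].
  split; last by rewrite n1 n2 n3' X3 X2.
  move=> X /(cosetsP hq)[s ->] c.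
  by case: (rP s c) => r; [constructor 1|constructor 2|constructor 3];
    apply/eqP; rewrite ?d1P ?d2P ?d3P ?r.
- move=> q0; have m0 := census_mod0 hq q0; rewrite -/q in m0.
  have e3 : (3%:R = 0 :> F)%R by apply/eqP; rewrite three_eq0 -/q q0.
  have m1 := num_tan3 hq e3; rewrite -/q in m1.
  have p1 : 0 < num (fun s : quad F => (cw s == 3) && (tan3 s == 1)).
    by rewrite m1 muln_gt0 !subn_gt0 -{1}(exp1n 2) ltn_exp2r // /q; lia.
  have p0 : 0 < num (fun s : quad F => (cw s == 3) && (tan3 s == 0)).
    rewrite -(@ltn_pmul2l 2) // m0 muln0 !muln_gt0 /= addn_gt0 orbT /=; rewrite /q; lia.
  have [d1 n1 d1P] := class_dist hq (Am3_char3 hq e3) p1.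
  have [d2 n2 d2P] := class_dist hq (Am3_char3 hq e3) p0.
  exists d1, d2; split; first exact: dist_neq p1 d1P d2P.
  split; last first.
    have E : q ^ 2 - q = q * q.-1 by rewrite -mulnn -subn1 mulnBr muln1.
    by rewrite n1 n2 m0 m1 E addn1 !subn1.
  move=> X /(cosetsP hq)[s ->] c.
  have : tan3 s = 1 \/ tan3 s = 0 by rewrite /tan3; case: (_ && _); [left|right].
  by case=> r; [left|right]; apply/eqP; rewrite ?d1P ?d2P ?r.
Qed.
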